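(* Let $E$ be a Dedekind complete Riesz space with weak order unit $e>0$, and let $E_e$ be the principal ideal generated by $e$. For a strictly positive linear functional $\varphi:E_e\to\mathbf{R}$, let $d_\varphi$ be the metric on $E$ given by $d_\varphi(x,y)=\varphi(|x-y|\wedge e)$ for $x,y\in E$, and let $\tau_\varphi$ be the topology it generates. Then the following are equivalent: (i) There exist a probability measure space $(X,\Sigma,\mu)$ and an onto lattice isomorphism $T:E\to L^0(\mu)$ such that $T(e)=\mathbf{1}$. (ii) There exists a strictly positive order continuous linear functional $\varphi:E_e\to\mathbf{R}$ such that the metric $d_\varphi$ is complete. (iii) There exists a strictly positive order continuous linear functional $\psi:E_e\to\mathbf{R}$ and $E$ is laterally complete. Moreover, in such case, $E_e$ is lattice isomorphic onto $L^\infty(\mu)$ (with $\mu$ as in (i)), the metrics $d_\varphi$ and $d_\psi$ (with $\varphi$ as in (ii) and $\psi$ as in (iii)) are topologically equivalent, i.e., $\tau_\varphi=\tau_\psi$, and $E$ has the countable sup property.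
   Context: Write $x>0$ for $x\ge 0$, $x\neq 0$, and $E^+=\{x\in E:x\ge 0\}$. For $e>0$ in a Riesz space $E$, the principal ideal generated by $e$ is $E_e=\{y\in E:|y|\le\lambda e\text{ for some }\lambda\in\mathbf{R}\}$. A net $(x_\alpha)_{\alpha\in A}$ in $E$ is order convergent to $x\in E$ if there is a net $(y_\alpha)_{\alpha\in A}$ in $E$ with the same index set such that $y_\alpha\downarrow 0$ and $|x_\alpha-x|\le y_\alpha$ for all $\alpha$. The vector $e>0$ is a weak order unit if for each $x\in E$ there is a net with values in $E_e$ that is order convergent to $x$. A linear functional $\varphi:E_e\to\mathbf{R}$ is strictly positive if $\varphi(x)>0$ whenever $x>0$. It is order continuous if $\varphi(x_\alpha)\to 0$ for every net $(x_\alpha)$ in $E_e$ that is order convergent to $0$ in $E_e$. $E$ is Dedekind complete if every non-empty subset that is bounded above has a supremum. It is laterally complete if the supremum of every (pairwise) disjoint subset of $E^+$ exists in $E$. $E$ has the countable sup property if every subset $S\subseteq E$ whose supremum exists in $E$ has an at most countable subset with the same supremum as $S$. A lattice isomorphism is an injective linear map preserving the lattice operations; ''onto'' means it is surjective. A probability measure space $(X,\Sigma,\mu)$ is a non-empty set $X$ with a $\sigma$-algebra $\Sigma$ and a $\sigma$-additive measure $\mu$ with $\mu(X)=1$. $L^0(\mu)$ is the Riesz space of $\mu$-a.e. equivalence classes of measurable functions $X\to\mathbf{R}$ with the a.e. pointwise order, $L^\infty(\mu)$ is its ideal of essentially bounded classes, and $\mathbf{1}$ is the class of the constant function $1$. 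*)

(* Defs.v *)
From HB Require Import structures.
From mathcomp Require Import all_boot all_order all_algebra.
From mathcomp Require Import all_classical all_reals all_analysis.
From mathcomp Require Import measurable_realfun ess_sup_inf.

Set Implicit Arguments.
Unset Strict Implicit.
Unset Printing Implicit Defensive.

Import Order.TTheory GRing.Theory Num.Theory.
Import numFieldNormedType.Exports.

Local Open Scope classical_set_scope.
Local Open Scope ring_scope.

(* [Order.Lattice] cannot be joined with [GRing.Lmodule] directly, since
   hierarchy-builder would require the join to precede [Num.RealDomain]; the
   lattice operations are therefore fields, and every Riesz space receives its
   [Order.Lattice] structure right after. *)
HB.mixin Record isRieszSpace (R : realType) (E : Type)
    of GRing.Lmodule R E & Num.POrderedZmodule E := {
  riesz_meet : E -> E -> E ;
  riesz_join : E -> E -> E ;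
  riesz_lexI : forall x y z : E,
    (x <= riesz_meet y z) = (x <= y) && (x <= z) ;
  riesz_leUx : forall x y z : E,
    (riesz_join x y <= z) = (x <= z) && (y <= z) ;
  riesz_leD2r_subdef : forall z x y : E, x <= y -> x + z <= y + z ;
  riesz_scale_ge0_subdef : forall (a : R) (x : E),
    0 <= a -> 0 <= x -> 0 <= a *: x
}.

#[short(type="rieszSpaceType")]
HB.structure Definition RieszSpace (R : realType) :=
  { E of GRing.Lmodule R E & Num.POrderedZmodule E & isRieszSpace R E }.

HB.instance Definition _ (R : realType) (E : rieszSpaceType R) :=
  Order.POrder_MeetJoin_isLattice.Build ring_display (RieszSpace.sort E)
    (@riesz_lexI R E) (@riesz_leUx R E).

Reserved Notation "x `\/` y" (at level 50, left associativity).
Reserved Notation "x `/\` y" (at level 48, left associativity).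
Notation "x `\/` y" := (@Order.join ring_display _ x y) : ring_scope.
Notation "x `/\` y" := (@Order.meet ring_display _ x y) : ring_scope.

Definition rabs (R : realType) (E : rieszSpaceType R) (x : E) : E := x `\/` - x.

Section riesz_theory.
Context {R : realType} {E : rieszSpaceType R}.
Implicit Types (x y z u v e : E) (a : R).

Lemma riesz_leD2r z x y : x <= y -> x + z <= y + z.
Proof. exact: riesz_leD2r_subdef. Qed.

Lemma riesz_scale_ge0 a x : 0 <= a -> 0 <= x -> 0 <= a *: x.
Proof. exact: riesz_scale_ge0_subdef. Qed.

Lemma riesz_leD x y u v : x <= y -> u <= v -> x + u <= y + v.
Proof.
move=> xy uv; apply: (le_trans (riesz_leD2r u xy)).
by rewrite ![y + _]addrC; exact: riesz_leD2r.
Qed.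

Lemma riesz_subr_ge0 x y : (0 <= y - x) = (x <= y).
Proof.
apply/idP/idP => h.
  by have := riesz_leD2r x h; rewrite add0r subrK.
by have := riesz_leD2r (- x) h; rewrite subrr.
Qed.

Lemma riesz_leN x y : x <= y -> - y <= - x.
Proof.
by rewrite -(riesz_subr_ge0 x y) -(riesz_subr_ge0 (- y)) opprK addrC.
Qed.

Lemma riesz_oppr_le0 x : 0 <= x -> - x <= 0.
Proof. by move=> /riesz_leN; rewrite oppr0. Qed.

Lemma riesz_leZ a x y : 0 <= a -> x <= y -> a *: x <= a *: y.
Proof.
move=> a0; rewrite -(riesz_subr_ge0 x) -(riesz_subr_ge0 (a *: x)) -scalerBr.
exact: riesz_scale_ge0.
Qed.

Lemma riesz_leZl a b x : 0 <= x -> a <= b -> a *: x <= b *: x.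
Proof.
move=> x0 ab; rewrite -riesz_subr_ge0 -scalerBl.
by apply: riesz_scale_ge0; rewrite ?subr_ge0.
Qed.

Lemma rabs_le x y : (rabs x <= y) = (x <= y) && (- x <= y).
Proof. exact: leUx. Qed.

Lemma rabs_ler x : x <= rabs x. Proof. exact: leUl. Qed.
Lemma rabs_leN x : - x <= rabs x. Proof. exact: leUr. Qed.

Lemma rabs_ge0 x : 0 <= rabs x.
Proof.
have : 0 <= rabs x + rabs x.
  by rewrite -(subrr x); apply: riesz_leD; [exact: rabs_ler|exact: rabs_leN].
rewrite -mulr2n -scaler_nat => /(@riesz_leZ (2^-1)).
by rewrite scaler0 scalerA mulVf ?pnatr_eq0// scale1r; apply.
Qed.

Lemma rabsN x : rabs (- x) = rabs x.
Proof. by rewrite /rabs opprK joinC. Qed.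

Lemma rabsB x y : rabs (x - y) = rabs (y - x).
Proof. by rewrite -rabsN opprB. Qed.

Lemma ger0_rabs x : 0 <= x -> rabs x = x.
Proof.
move=> x0; apply/eqP; rewrite eq_le rabs_ler andbT rabs_le lexx/=.
exact: le_trans (riesz_oppr_le0 x0) x0.
Qed.

Lemma rabs_id x : rabs (rabs x) = rabs x.
Proof. by rewrite ger0_rabs// rabs_ge0. Qed.

Lemma rabs0 : rabs (0 : E) = 0. Proof. exact: ger0_rabs. Qed.

Lemma rabs0_eq0 x : rabs x = 0 -> x = 0.
Proof.
move=> x0; apply/eqP; rewrite eq_le.
apply/andP; split; first by rewrite -[leRHS]x0 rabs_ler.
by have := riesz_leN (rabs_leN x); rewrite x0 oppr0 opprK.
Qed.

Lemma rabsD x y : rabs (x + y) <= rabs x + rabs y.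
Proof.
rewrite rabs_le opprD; apply/andP.
by split; apply: riesz_leD; rewrite ?rabs_ler ?rabs_leN.
Qed.

Lemma rabsZ_le a x : rabs (a *: x) <= `|a| *: rabs x.
Proof.
have [a0|a0] := leP 0 a; rewrite rabs_le.
  by rewrite -scalerN ger0_norm// !riesz_leZ// ?rabs_ler ?rabs_leN.
have Na0 : 0 <= - a by rewrite oppr_ge0 ltW.
rewrite ltr0_norm// -scaleNr.
by rewrite -[a *: x]opprK -scaleNr -scalerN !riesz_leZ// ?rabs_ler ?rabs_leN.
Qed.

Lemma rabsI_le x y : rabs (x `/\` y) <= rabs x + rabs y.
Proof.
rewrite rabs_le; apply/andP; split.
  apply: (le_trans (leIl _ _)); rewrite -[leLHS]addr0.
  by rewrite riesz_leD ?rabs_ler ?rabs_ge0.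
rewrite -[leRHS]opprK; apply: riesz_leN; rewrite lexI opprD; apply/andP; split.
  rewrite -[leRHS]addr0; apply: riesz_leD.
    by rewrite -[leRHS]opprK riesz_leN// rabs_leN.
  by rewrite riesz_oppr_le0// rabs_ge0.
rewrite -[leRHS]add0r; apply: riesz_leD.
  by rewrite riesz_oppr_le0// rabs_ge0.
by rewrite -[leRHS]opprK riesz_leN// rabs_leN.
Qed.

Lemma rabsU_le x y : rabs (x `\/` y) <= rabs x + rabs y.
Proof.
have hx : x <= rabs x + rabs y.
  by rewrite -[leLHS]addr0 riesz_leD ?rabs_ler ?rabs_ge0.
have hy : y <= rabs x + rabs y.
  by rewrite -[leLHS]add0r riesz_leD ?rabs_ler ?rabs_ge0.
rewrite rabs_le leUx hx hy/=.
apply: (le_trans (riesz_leN (leUl x y))).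
by rewrite -[leLHS]addr0 riesz_leD ?rabs_leN ?rabs_ge0.
Qed.

Lemma riesz_meetD x y e : 0 <= x -> 0 <= y -> 0 <= e ->
  (x + y) `/\` e <= x `/\` e + y `/\` e.
Proof.
move=> x0 y0 e0; set w := (x + y) `/\` e.
have wxy : w <= x + y by exact: leIl.
have we : w <= e by exact: leIr.
have le_addr u v : 0 <= v -> u <= u + v.
  by move=> v0; rewrite -[leLHS]addr0 riesz_leD.
have mI0 u v : 0 <= u -> 0 <= v -> 0 <= u `/\` v by move=> *; rewrite lexI; apply/andP.
suff : w - y `/\` e <= x `/\` e.
  by move=> /(riesz_leD2r (y `/\` e)); rewrite subrK.
have yeN : - (y `/\` e) <= 0 by rewrite riesz_oppr_le0// mI0.
rewrite lexI; apply/andP; split; last first.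
  by rewrite -[leRHS]addr0; exact: riesz_leD.
suff : w - x <= y `/\` e.
  move=> /(riesz_leD2r (x - y `/\` e)).
  by rewrite addrA subrK addrCA subrr addr0.
rewrite lexI; apply/andP; split.
  by have := riesz_leD2r (- x) wxy; rewrite [x + y]addrC addrK.
by rewrite -[leRHS]addr0 riesz_leD// riesz_oppr_le0.
Qed.

End riesz_theory.

Definition dedekind_complete (R : realType) (E : rieszSpaceType R) :=
  forall S : set E, has_sup S -> exists s, supremums S s.

Definition disjoint_elts (R : realType) (E : rieszSpaceType R) (x y : E) :=
  rabs x `/\` rabs y = 0.

(* The empty family is excluded: it has no supremum in a non-zero space. *)
Definition laterally_complete (R : realType) (E : rieszSpaceType R) :=
  forall S : set E, S !=set0 -> (forall x, S x -> 0 <= x) ->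
    (forall x y, S x -> S y -> x <> y -> disjoint_elts x y) ->
    exists s, supremums S s.

Definition countable_sup_property (R : realType) (E : rieszSpaceType R) :=
  forall (S : set E) (s : E), supremums S s ->
    exists C : set E, [/\ C `<=` S, countable C & supremums C s].

Record lattice_isomorphism (R : realType) (E F : rieszSpaceType R)
    (T : {linear E -> F}) : Prop := LatticeIsomorphism {
  lattice_iso_inj : injective T ;
  lattice_iso_join : {morph T : x y / x `\/` y} ;
  lattice_iso_meet : {morph T : x y / x `/\` y}
}.

Definition onto (A B : Type) (f : A -> B) := forall b, exists a, f a = b.

Record directedType := DirectedType {
  directed_sort :> Type ;
  dle : directed_sort -> directed_sort -> Prop ;
  dle_inhabited : inhabited directed_sort ;
  dle_refl : forall a, dle a a ;
  dle_trans : forall b a c, dle a b -> dle b c -> dle a c ;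
  dle_directed : forall a b, exists c, dle a c /\ dle b c
}.

(* The filter along which nets indexed by [A] converge. *)
Definition tails (A : directedType) : set_system A :=
  filter_from setT (fun a => [set b | dle a b]).
Arguments tails : clear implicits.

Section order_convergence.
Context {R : realType} {E : rieszSpaceType R}.

Definition decreases_to0 (A : directedType) (y : A -> E) :=
  (forall a b, dle a b -> y b <= y a) /\ infimums (range y) 0.

Definition order_cvg (A : directedType) (x : A -> E) (l : E) :=
  exists y : A -> E, decreases_to0 y /\ forall a, rabs (x a - l) <= y a.

End order_convergence.

Record rieszIdeal (R : realType) (E : rieszSpaceType R) := RieszIdeal {
  ideal_set : set E ;
  ideal0 : ideal_set 0 ;
  idealD : forall x y, ideal_set x -> ideal_set y -> ideal_set (x + y) ;
  idealZ : forall (a : R) x, ideal_set x -> ideal_set (a *: x) ;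
  ideal_solid : forall x y, ideal_set y -> rabs x <= rabs y -> ideal_set x
}.

Definition ideal_pred (R : realType) (E : rieszSpaceType R) (I : rieszIdeal E)
  : {pred E} := mem (ideal_set I).

Record ideal_type (R : realType) (E : rieszSpaceType R) (I : rieszIdeal E) :=
  IdealElt { ideal_val : E ; ideal_valP : ideal_val \in ideal_pred I }.

Section ideal_riesz.
Context {R : realType} {E : rieszSpaceType R} (I : rieszIdeal E).
Local Notation S := (ideal_pred I).
Local Notation sT := (ideal_type I).

HB.instance Definition _ := [isSub of sT for @ideal_val R E I].
HB.instance Definition _ := [Choice of sT by <:].

Lemma ideal_submod_closed : submod_closed S.
Proof.
split=> [|a x y]; first by rewrite inE; exact: ideal0.
by rewrite !inE => Sx Sy; apply: idealD => //; exact: idealZ.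
Qed.

HB.instance Definition _ := GRing.isSubmodClosed.Build R E S ideal_submod_closed.
HB.instance Definition _ := [SubChoice_isSubLmodule of sT by <:].

Lemma ideal_meet_closed : {in S &, forall x y, x `/\` y \in S}.
Proof.
move=> x y; rewrite !inE => Sx Sy.
apply: (@ideal_solid _ _ I _ (rabs x + rabs y)).
  by apply: idealD; [apply: ideal_solid Sx _|apply: ideal_solid Sy _];
    rewrite rabs_id.
by rewrite [leRHS]ger0_rabs ?rabsI_le// -[0]addr0 riesz_leD// rabs_ge0.
Qed.

Lemma ideal_join_closed : {in S &, forall x y, x `\/` y \in S}.
Proof.
move=> x y; rewrite !inE => Sx Sy.
apply: (@ideal_solid _ _ I _ (rabs x + rabs y)).
  by apply: idealD; [apply: ideal_solid Sx _|apply: ideal_solid Sy _];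
    rewrite rabs_id.
by rewrite [leRHS]ger0_rabs ?rabsU_le// -[0]addr0 riesz_leD// rabs_ge0.
Qed.


Definition ideal_meet (x y : sT) : sT := IdealElt (ideal_meet_closed (valP x) (valP y)).
Definition ideal_join (x y : sT) : sT := IdealElt (ideal_join_closed (valP x) (valP y)).

HB.instance Definition _ := [SubChoice_isSubPOrder of sT by <: with ring_display].

Lemma ideal_leE (x y : sT) : (x <= y) = (ideal_val x <= ideal_val y).
Proof. by []. Qed.

Lemma ideal_lexI (x y z : sT) :
  (x <= ideal_meet y z) = (x <= y) && (x <= z).
Proof. by rewrite !ideal_leE lexI. Qed.

Lemma ideal_leUx (x y z : sT) :
  (ideal_join x y <= z) = (x <= z) && (y <= z).
Proof. by rewrite !ideal_leE leUx. Qed.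

Lemma ideal_leD2r (z x y : sT) : x <= y -> x + z <= y + z.
Proof. by rewrite !ideal_leE; exact: riesz_leD2r. Qed.

Lemma ideal_scale_ge0 (a : R) (x : sT) : 0 <= a -> 0 <= x -> 0 <= a *: x.
Proof. by rewrite !ideal_leE; exact: riesz_scale_ge0. Qed.

HB.instance Definition _ := isRieszSpace.Build R sT
  ideal_lexI ideal_leUx ideal_leD2r ideal_scale_ge0.
HB.instance Definition _ := Order.POrder_MeetJoin_isLattice.Build
  ring_display sT (@riesz_lexI R sT) (@riesz_leUx R sT).

End ideal_riesz.

Section principal_ideal.
Context {R : realType} {E : rieszSpaceType R} (e : E).

Definition principal_set : set E := [set y | exists l : R, rabs y <= l *: e].

Lemma principal0 : principal_set 0.
Proof. by exists 0; rewrite rabs0 scale0r. Qed.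

Lemma principalD x y :
  principal_set x -> principal_set y -> principal_set (x + y).
Proof.
move=> [l xl] [m ym]; exists (l + m); rewrite scalerDl.
exact: le_trans (rabsD _ _) (riesz_leD xl ym).
Qed.

Lemma principalZ (a : R) x : principal_set x -> principal_set (a *: x).
Proof.
move=> [l xl]; exists (`|a| * l); rewrite -scalerA.
exact: le_trans (rabsZ_le _ _) (riesz_leZ (normr_ge0 a) xl).
Qed.

Lemma principal_solid x y :
  principal_set y -> rabs x <= rabs y -> principal_set x.
Proof. by move=> [l yl] xy; exists l; exact: le_trans xy yl. Qed.

Definition principal_ideal : rieszIdeal E :=
  RieszIdeal principal0 principalD principalZ principal_solid.

End principal_ideal.

Definition weak_order_unit (R : realType) (E : rieszSpaceType R) (e : E) :=
  0 < e /\ forall x : E, exists (A : directedType) (y : A -> E),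
    (forall a, principal_set e (y a)) /\ order_cvg y x.

Definition strictly_positive (R : realType) (E : rieszSpaceType R)
  (phi : {scalar E}) := forall x : E, 0 < x -> 0 < phi x.

Definition order_continuous (R : realType) (E : rieszSpaceType R)
    (phi : {scalar E}) :=
  forall (A : directedType) (x : A -> E), order_cvg x 0 ->
    phi (x a) @[a --> tails A] --> (0 : R).

Section L0.
Context d (X : measurableType d) (R : realType).
Variable mu : {measure set X -> \bar R}.

Local Open Scope quotient_scope.

Definition L0 : Type := {mfun_ mu, X >-> R}.

HB.instance Definition _ := Choice.on L0.
HB.instance Definition _ := EqQuotient.on L0.

Definition L0_repr (f : L0) : {mfun X >-> R} := repr f.
Definition L0_class (f : {mfun X >-> R}) : L0 := \pi_L0 f.

Local Coercion L0_repr : L0 >-> MeasurableFun.type.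

Implicit Types (f g h : L0) (a b : R).

Lemma L0_classE (h : {mfun X >-> R}) : \forall x \ae mu, L0_class h x = h x.
Proof.
have /eqP : \pi_L0 (repr (L0_class h)) = \pi_L0 h by rewrite reprK.
by rewrite eqmodE => /asboolP; apply: filterS => x; exact.
Qed.

Lemma L0P (f g : L0) : (\forall x \ae mu, f x = g x) -> f = g.
Proof.
move=> fg; rewrite -[f]reprK -[g]reprK; apply/eqP.
by rewrite eqmodE; apply/asboolP; apply: filterS fg.
Qed.

Definition L0_zero : L0 := L0_class 0.
Definition L0_opp (f : L0) : L0 := L0_class (- L0_repr f).
Definition L0_add (f g : L0) : L0 := L0_class (L0_repr f + L0_repr g).
Definition L0_scale (a : R) (f : L0) : L0 := L0_class (a *: L0_repr f).
Definition L0_meet (f g : L0) : L0 := L0_class (min_mfun f g).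
Definition L0_join (f g : L0) : L0 := L0_class (max_mfun f g).
Definition L0_le (f g : L0) : bool := `[< \forall x \ae mu, f x <= g x >].

Lemma L0_zeroE : \forall x \ae mu, L0_zero x = 0.
Proof. exact: L0_classE. Qed.

Lemma L0_oppE f : \forall x \ae mu, L0_opp f x = - f x.
Proof. exact: L0_classE. Qed.

Lemma L0_addE f g : \forall x \ae mu, L0_add f g x = f x + g x.
Proof. exact: L0_classE. Qed.

Lemma L0_scaleE a f : \forall x \ae mu, L0_scale a f x = a * f x.
Proof. exact: L0_classE. Qed.

Lemma L0_meetE f g : \forall x \ae mu, L0_meet f g x = Num.min (f x) (g x).
Proof. exact: L0_classE. Qed.

Lemma L0_joinE f g : \forall x \ae mu, L0_join f g x = Num.max (f x) (g x).
Proof. exact: L0_classE. Qed.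

Lemma L0_addA : associative L0_add.
Proof.
move=> f g h; apply: L0P; near=> x.
have -> : L0_add f (L0_add g h) x = f x + L0_add g h x by near: x; exact: L0_addE.
have -> : L0_add (L0_add f g) h x = L0_add f g x + h x by near: x; exact: L0_addE.
have -> : L0_add g h x = g x + h x by near: x; exact: L0_addE.
have -> : L0_add f g x = f x + g x by near: x; exact: L0_addE.
exact: addrA.
Unshelve. all: by end_near. Qed.

Lemma L0_addC : commutative L0_add.
Proof. by move=> f g; rewrite /L0_add addrC. Qed.

Lemma L0_add0 : left_id L0_zero L0_add.
Proof.
move=> f; apply: L0P; near=> x.
have -> : L0_add L0_zero f x = L0_zero x + f x by near: x; exact: L0_addE.
have -> : L0_zero x = 0 by near: x; exact: L0_zeroE.
exact: add0r.
Unshelve. all: by end_near. Qed.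

Lemma L0_addN : left_inverse L0_zero L0_opp L0_add.
Proof.
move=> f; apply: L0P; near=> x.
have -> : L0_add (L0_opp f) f x = L0_opp f x + f x by near: x; exact: L0_addE.
have -> : L0_zero x = 0 by near: x; exact: L0_zeroE.
have -> : L0_opp f x = - f x by near: x; exact: L0_oppE.
exact: addNr.
Unshelve. all: by end_near. Qed.

HB.instance Definition _ :=
  GRing.isZmodule.Build L0 L0_addA L0_addC L0_add0 L0_addN.

Lemma L0_scaleA a b f : L0_scale a (L0_scale b f) = L0_scale (a * b) f.
Proof.
apply: L0P; near=> x.
have -> : L0_scale a (L0_scale b f) x = a * L0_scale b f x.
  by near: x; exact: L0_scaleE.
have -> : L0_scale b f x = b * f x by near: x; exact: L0_scaleE.
have -> : L0_scale (a * b) f x = a * b * f x by near: x; exact: L0_scaleE.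
exact: mulrA.
Unshelve. all: by end_near. Qed.

Lemma L0_scale1 : left_id 1 L0_scale.
Proof. by move=> f; rewrite /L0_scale scale1r; exact: reprK. Qed.

Lemma L0_scaleDr : right_distributive L0_scale +%R.
Proof.
move=> a f g; rewrite -[f + g]/(L0_add f g) -[RHS]/(L0_add _ _).
apply: L0P; near=> x.
have -> : L0_scale a (L0_add f g) x = a * L0_add f g x.
  by near: x; exact: L0_scaleE.
have -> : L0_add f g x = f x + g x by near: x; exact: L0_addE.
have -> : L0_add (L0_scale a f) (L0_scale a g) x =
          L0_scale a f x + L0_scale a g x.
  by near: x; exact: L0_addE.
have -> : L0_scale a f x = a * f x by near: x; exact: L0_scaleE.
have -> : L0_scale a g x = a * g x by near: x; exact: L0_scaleE.
exact: mulrDr.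
Unshelve. all: by end_near. Qed.

Lemma L0_scaleDl f : {morph L0_scale^~ f : a b / a + b}.
Proof.
move=> a b; rewrite -[RHS]/(L0_add _ _); apply: L0P; near=> x.
have -> : L0_scale (a + b) f x = (a + b) * f x by near: x; exact: L0_scaleE.
have -> : L0_add (L0_scale a f) (L0_scale b f) x =
          L0_scale a f x + L0_scale b f x.
  by near: x; exact: L0_addE.
have -> : L0_scale a f x = a * f x by near: x; exact: L0_scaleE.
have -> : L0_scale b f x = b * f x by near: x; exact: L0_scaleE.
exact: mulrDl.
Unshelve. all: by end_near. Qed.

HB.instance Definition _ := GRing.Zmodule_isLmodule.Build R L0
  L0_scaleA L0_scale1 L0_scaleDr L0_scaleDl.

Lemma L0_leP f g : reflect (\forall x \ae mu, f x <= g x) (L0_le f g).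
Proof. exact: asboolP. Qed.

Lemma L0_le_refl : reflexive L0_le.
Proof. by move=> f; apply/L0_leP; apply: aeW. Qed.

Lemma L0_le_anti : antisymmetric L0_le.
Proof.
move=> f g /andP[/L0_leP fg /L0_leP gf]; apply: L0P.
by apply: filterS2 fg gf => x fg gf; apply/eqP; rewrite eq_le fg gf.
Qed.

Lemma L0_le_trans : transitive L0_le.
Proof.
move=> g f h /L0_leP fg /L0_leP gh; apply/L0_leP.
by apply: filterS2 fg gh => x; exact: le_trans.
Qed.

HB.instance Definition _ := Order.Le_isPOrder.Build ring_display L0
  L0_le_refl L0_le_anti L0_le_trans.

Lemma L0_lexI f g h : (f <= L0_meet g h) = (f <= g) && (f <= h).
Proof.
apply/L0_leP/andP => [fgh|[/L0_leP fg /L0_leP fh]].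
  split; apply/L0_leP; apply: filterS2 fgh (L0_meetE g h) => x + E.
    by rewrite E le_min => /andP[].
  by rewrite E le_min => /andP[].
by apply: filterS3 fg fh (L0_meetE g h) => x fg fh ->; rewrite le_min fg.
Qed.

Lemma L0_leUx f g h : (L0_join f g <= h) = (f <= h) && (g <= h).
Proof.
apply/L0_leP/andP => [fgh|[/L0_leP fg /L0_leP fh]].
  split; apply/L0_leP; apply: filterS2 fgh (L0_joinE f g) => x + E.
    by rewrite E ge_max => /andP[].
  by rewrite E ge_max => /andP[].
by apply: filterS3 fg fh (L0_joinE f g) => x fg fh ->; rewrite ge_max fg.
Qed.

Lemma L0_leD2r h f g : f <= g -> f + h <= g + h.
Proof.
move=> /L0_leP fg; apply/L0_leP.
by apply: filterS3 fg (L0_addE f h) (L0_addE g h) => x fg -> ->; rewrite lerD2r.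
Qed.

Lemma L0_scale_ge0 (a : R) f : 0 <= a -> 0 <= f -> 0 <= a *: f.
Proof.
move=> a0 /L0_leP f0; apply/L0_leP.
apply: filterS3 f0 L0_zeroE (L0_scaleE a f) => x f0 z0 ->.
by move: f0; rewrite z0; exact: mulr_ge0.
Qed.

HB.instance Definition _ := isRieszSpace.Build R L0
  L0_lexI L0_leUx L0_leD2r L0_scale_ge0.
HB.instance Definition _ := Order.POrder_MeetJoin_isLattice.Build
  ring_display L0 (@riesz_lexI R L0) (@riesz_leUx R L0).

End L0.

Section Linfty.
Context d (X : measurableType d) (R : realType) (mu : probability X R).

Definition Linfty_set : set (L0 mu) :=
  [set f | finite_norm mu +oo%E (L0_repr f)].

Lemma Linfty_setP (f : L0 mu) :
  Linfty_set f <-> exists M : R, \forall x \ae mu, `|L0_repr f x| <= M.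
Proof.
rewrite /Linfty_set /finite_norm /= unlock ifT; last first.
  by rewrite [ltRHS](probability_setT mu) lte01.
split=> [/ereal_inf_lt[[M||]//= fM _]|[M fM]].
- by exists M; apply: filterS fM => x; rewrite /= lee_fin.
- by exists 0; apply: filterS fM => x; rewrite /= leNgt ltNyr.
- apply: (@le_lt_trans _ _ M%:E); last exact: ltry.
  by apply: ereal_inf_lbound; apply: filterS fM => x; rewrite /= lee_fin.
Qed.

Lemma L0_rabsE (f : L0 mu) :
  \forall x \ae mu, L0_repr (rabs f) x = `|L0_repr f x|.
Proof.
apply: filterS2 (L0_joinE f (L0_opp f)) (L0_oppE f) => x /= + E.
by rewrite E maxrN => <-.
Qed.

Lemma Linfty0 : Linfty_set 0.
Proof.
apply/Linfty_setP; exists 0.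
by apply: filterS (L0_zeroE mu) => x ->; rewrite normr0.
Qed.

Lemma LinftyD f g : Linfty_set f -> Linfty_set g -> Linfty_set (f + g).
Proof.
move=> /Linfty_setP[M fM] /Linfty_setP[N gN]; apply/Linfty_setP.
exists (M + N); apply: filterS3 fM gN (L0_addE f g) => x fM gN ->.
exact: le_trans (ler_normD _ _) (lerD fM gN).
Qed.

Lemma LinftyZ (a : R) f : Linfty_set f -> Linfty_set (a *: f).
Proof.
move=> /Linfty_setP[M fM]; apply/Linfty_setP; exists (`|a| * M).
apply: filterS2 fM (L0_scaleE a f) => x fM ->.
by rewrite normrM ler_wpM2l.
Qed.

Lemma Linfty_solid f g : Linfty_set g -> rabs f <= rabs g -> Linfty_set f.
Proof.
move=> /Linfty_setP[M gM] /L0_leP fg; apply/Linfty_setP; exists M.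
have {}fg : \forall x \ae mu, `|L0_repr f x| <= `|L0_repr g x|.
  by apply: filterS3 fg (L0_rabsE f) (L0_rabsE g) => x + <- <-.
by apply: filterS2 gM fg => x gx fx; exact: le_trans fx gx.
Qed.

Definition Linfty : rieszIdeal (L0 mu) :=
  RieszIdeal Linfty0 LinftyD LinftyZ Linfty_solid.

End Linfty.

Section dphi.
Context {R : realType} {E : rieszSpaceType R} {e : E}.

Lemma weak_unit_ge0 : weak_order_unit e -> 0 <= e.
Proof. by move=> [/ltW]. Qed.

Lemma truncation_subproof : weak_order_unit e -> forall x : E,
  rabs x `/\` e \in ideal_pred (principal_ideal e).
Proof.
move=> /weak_unit_ge0 e0 x; rewrite inE; exists 1; rewrite scale1r ger0_rabs.
  exact: leIr.
by rewrite lexI rabs_ge0.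
Qed.

Definition truncation (he : weak_order_unit e) (x : E) :
  ideal_type (principal_ideal e) := IdealElt (truncation_subproof he x).

Variables (he : weak_order_unit e).
Variables (phi : {scalar ideal_type (principal_ideal e)}).
Variables (phi_pos : strictly_positive phi).

Definition dphi (x y : E) : R := phi (truncation he (x - y)).

Lemma phi_ge0 x : 0 <= x -> 0 <= phi x.
Proof.
rewrite le_eqVlt => /predU1P[<-|/phi_pos/ltW//].
by rewrite raddf0.
Qed.

Lemma phi_le x y : x <= y -> phi x <= phi y.
Proof.
by rewrite -subr_ge0 -raddfB -(riesz_subr_ge0 x) => /phi_ge0.
Qed.

Lemma dphixx x : dphi x x = 0.
Proof.
rewrite /dphi (_ : truncation _ _ = 0) ?raddf0//.
apply: val_inj; rewrite /= subrr rabs0; apply/eqP.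
by rewrite -leEmeet weak_unit_ge0.
Qed.

Lemma dphi_sym x y : dphi x y = dphi y x.
Proof.
by rewrite /dphi; congr (phi _); apply: val_inj; rewrite /= rabsB.
Qed.

Lemma dphi_triangle y x z : dphi x z <= dphi x y + dphi y z.
Proof.
rewrite /dphi -raddfD; apply: phi_le; rewrite ideal_leE /=.
have e0 := weak_unit_ge0 he.
apply: le_trans (riesz_meetD (rabs_ge0 _) (rabs_ge0 _) e0).
apply: leI2 => //; rewrite (_ : x - z = (x - y) + (y - z)) ?rabsD//.
by rewrite addrA subrK.
Qed.

Lemma weak_unit_disjoint x : rabs x `/\` e = 0 -> x = 0.
Proof.
move=> xe0; have [A [y [ye [z [[_ [_ z0]] yz]]]]] := he.2 (rabs x).
have e0 := weak_unit_ge0 he.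
apply: rabs0_eq0; apply/eqP; rewrite eq_le rabs_ge0 andbT.
apply: z0 => _ [a _ <-].
have [l yl] := ye a.
pose m := Num.max 1 l.
have m1 : 1 <= m by rewrite le_max lexx.
have m0 : 0 <= m by rewrite (le_trans _ m1).
have mn0 : m != 0 by rewrite gt_eqF// (lt_le_trans _ m1).
have yx0 : rabs (y a) `/\` rabs x <= 0.
  set w := _ `/\` _.
  suff : m^-1 *: w <= 0.
    by move=> /(riesz_leZ m0); rewrite scalerA mulfV// scale1r scaler0.
  rewrite -xe0 lexI; apply/andP; split.
    rewrite -[leRHS]scale1r -[1](mulVf mn0) -scalerA riesz_leZ ?invr_ge0//.
    apply: (le_trans (leIr _ _)).
    by rewrite -[leLHS]scale1r riesz_leZl// rabs_ge0.
  rewrite -[leRHS]scale1r -[1](mulVf mn0) -scalerA riesz_leZ ?invr_ge0//.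
  apply: (le_trans (leIl _ _)); apply: (le_trans yl).
  by apply: riesz_leZl => //; rewrite le_max lexx orbT.
have -> : rabs x = (rabs (y a) + rabs (y a - rabs x)) `/\` rabs x.
  apply/esym/eqP; rewrite eq_le leIr lexI lexx andbT/=.
  have := rabsD (y a) (rabs x - y a).
  by rewrite [y a + _]addrC subrK rabs_id [rabs (rabs x - _)]rabsB.
apply: le_trans (riesz_meetD (rabs_ge0 _) (rabs_ge0 _) (rabs_ge0 _)) _.
rewrite -[leRHS]add0r; apply: riesz_leD => //.
exact: le_trans (leIl _ _) (yz a).
Qed.

Lemma dphi_positivity x y : dphi x y = 0 -> x = y.
Proof.
move=> d0; apply/eqP; rewrite -subr_eq0; apply/eqP/weak_unit_disjoint.
have t0 : 0 <= truncation he (x - y).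
  by rewrite ideal_leE /= lexI rabs_ge0 weak_unit_ge0.
move: t0; rewrite le_eqVlt => /predU1P[t0|/phi_pos].
  by rewrite -[LHS]/(ideal_val (truncation he (x - y))) -t0.
by rewrite -/(dphi x y) d0 ltxx.
Qed.

(* The proof arguments only serve to make [dphi] a metric: [he] gives
   non-degeneracy via [weak_unit_disjoint]. *)
Definition metric_dphi (u : weak_order_unit e)
  (f : {scalar ideal_type (principal_ideal e)}) (_ : strictly_positive f) :
  Type := E.

HB.instance Definition _ := Choice.on (metric_dphi he phi_pos).
HB.instance Definition _ := isMetric.Build R
  (metric_dphi he phi_pos)
  dphixx dphi_positivity dphi_sym dphi_triangle.

End dphi.

Definition complete_metric (R : realType) (M : metricType R) :=
  forall u : nat -> M, cauchy (u @ \oo) -> exists l : M, u @ \oo --> l.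

Definition L0_representation (R : realType) (E : rieszSpaceType R) (e : E)
    d (X : measurableType d) (mu : probability X R)
    (T : {linear E -> L0 mu}) :=
  [/\ lattice_isomorphism T, onto T & T e = L0_class mu 1].

(* Main.v *)
Require Import Defs.
From HB Require Import structures.
From mathcomp Require Import all_boot all_order all_algebra.
From mathcomp Require Import all_classical all_reals all_analysis.
From mathcomp Require Import measurable_realfun lra.

Set Implicit Arguments.
Unset Strict Implicit.
Unset Printing Implicit Defensive.

Import Order.TTheory GRing.Theory Num.Theory.
Import numFieldNormedType.Exports.

Local Open Scope classical_set_scope.
Local Open Scope ring_scope.

(* From (i), [phi x = \int T x] is strictly positive and order continuous, and [d_phi]
   is convergence in measure, which is complete: a Cauchy sequence has a subsequence
   converging almost everywhere. From (ii), suitable finite partial sums of a disjoint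
   family form a [d_phi]-Cauchy sequence whose limit is the supremum of the family.

   From (iii), let X be the Stone space of the complete Boolean algebra of components
   of [e]. Order continuity of [psi] makes the subsets of X that are clopen up to a null
   set into a sigma-algebra on which [psi] induces a measure. An element x of E is
   represented by the function [w |-> sup {t | the component {x > t e} belongs to w}],
   finite almost everywhere. Every nonnegative step function is the image of the
   supremum of a disjoint sequence, which exists by lateral completeness, and every
   nonnegative measurable function is a uniform limit of such step functions.

   For two functionals, were the topologies different, there would be [z_n] in [[0, e]]
   with [phi z_n <= 2^-n] and [psi z_n] bounded away from 0, whereas the suprema of the
   tails of [z_n] decrease to 0. *)

(** * Arithmetic in Riesz spaces *)

(** Null sets carry the construction of the representation. The supremum of countably many
    components may correspond to a set strictly larger than the union of their clopen sets, so the
    clopen sets alone need not form a sigma-algebra; order continuity is what covers the excess by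
    components of arbitrarily small value, and likewise the points where an element would take an
    infinite value. In the converse direction the infimum of an uncountable net in [L0] is not a
    pointwise infimum, and dominated convergence does not reach it. Strict positivity of the
    integral reduces the question to sequences. Truncation by [e] bounds the value of every finite
    disjoint sum by [phi e]. A disjoint family of any cardinality is thereby exhausted by a sequence
    of finite subfamilies, and this is where completeness of a metric can produce a supremum. The
    weak unit acts mainly through one fact: an element disjoint from [e] is 0. It gives the
    separation of points by [d_phi] and the calculus of the carriers. *)

Section riesz_arithmetic.
Context {R : realType} {E : rieszSpaceType R}.
Implicit Types (x y z u v w : E) (a b : R) (S : set E).

Lemma riesz_lerD2r z x y : (x + z <= y + z) = (x <= y).
Proof.
apply/idP/idP => [h|]; last exact: riesz_leD2r.
by have := riesz_leD2r (- z) h; rewrite !addrK.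
Qed.

Lemma riesz_lerD2l z x y : (z + x <= z + y) = (x <= y).
Proof. by rewrite ![z + _]addrC riesz_lerD2r. Qed.

Lemma riesz_leBlD x y z : (x - y <= z) = (x <= z + y).
Proof. by rewrite -[RHS](riesz_lerD2r (- y)) addrK. Qed.

Lemma riesz_leBrD x y z : (x <= z - y) = (x + y <= z).
Proof. by rewrite -[RHS](riesz_lerD2r (- y)) addrK. Qed.

Lemma riesz_leN2 x y : (- x <= - y) = (y <= x).
Proof. by apply/idP/idP => /riesz_leN //; rewrite !opprK. Qed.

Lemma riesz_lerDl x y : 0 <= y -> x <= x + y.
Proof. by move=> y0; rewrite -[leLHS]addr0 riesz_lerD2l. Qed.

Lemma riesz_lerDr x y : 0 <= y -> x <= y + x.
Proof. by move=> y0; rewrite addrC riesz_lerDl. Qed.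

Lemma riesz_addr_ge0 x y : 0 <= x -> 0 <= y -> 0 <= x + y.
Proof. by move=> x0 y0; rewrite -[0]addr0 riesz_leD. Qed.

Lemma riesz_lerBr_le0 x y : (x <= x - y) = (y <= 0).
Proof. by rewrite -[leLHS]addr0 riesz_lerD2l -riesz_leN2 oppr0 opprK. Qed.

Lemma riesz_lerZ a x y : 0 < a -> (a *: x <= a *: y) = (x <= y).
Proof.
move=> a0; apply/idP/idP; last exact/riesz_leZ/ltW.
have : 0 <= a^-1 by rewrite invr_ge0 ltW.
by move=> /[swap] /riesz_leZ /[apply]; rewrite !scalerA mulVf ?gt_eqF// !scale1r.
Qed.

Lemma riesz_meet_ge0 x y : 0 <= x -> 0 <= y -> 0 <= x `/\` y.
Proof. by rewrite lexI => -> ->. Qed.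

Lemma riesz_joinDr z x y : (x `\/` y) + z = (x + z) `\/` (y + z).
Proof.
apply/eqP; rewrite eq_le leUx !riesz_lerD2r leUl leUr andbT.
by rewrite -riesz_leBrD leUx !riesz_leBrD leUl leUr.
Qed.

Lemma riesz_meetDr z x y : (x `/\` y) + z = (x + z) `/\` (y + z).
Proof.
apply/eqP; rewrite eq_le lexI !riesz_lerD2r leIl leIr/=.
by rewrite -riesz_leBlD lexI !riesz_leBlD leIl leIr.
Qed.

Lemma riesz_oppU x y : - (x `\/` y) = - x `/\` - y.
Proof.
apply/eqP; rewrite eq_le lexI !riesz_leN2 leUl leUr/=.
rewrite -riesz_leN2 opprK leUx.
by rewrite -(riesz_leN2 _ x) -(riesz_leN2 _ y) opprK leIl leIr.
Qed.

Lemma riesz_oppI x y : - (x `/\` y) = - x `\/` - y.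
Proof. by rewrite -[RHS]opprK riesz_oppU !opprK. Qed.

Lemma riesz_joinDmeet x y : x `\/` y + x `/\` y = x + y.
Proof.
have -> : x `\/` y = (x + y) - (x `/\` y).
  by rewrite riesz_oppI [RHS]addrC riesz_joinDr addKr [x + y]addrC addKr joinC.
exact: subrK.
Qed.

Lemma riesz_scaleU a x y : 0 <= a -> a *: (x `\/` y) = a *: x `\/` a *: y.
Proof.
rewrite le_eqVlt => /predU1P[<-|a0]; first by rewrite !scale0r joinxx.
have an0 : a != 0 by rewrite gt_eqF.
apply/eqP; rewrite eq_le leUx !riesz_lerZ// leUl leUr andbT.
have av0 : 0 < a^-1 by rewrite invr_gt0.
rewrite -(riesz_lerZ _ _ av0) scalerA mulVf// scale1r leUx.
rewrite -(riesz_lerZ x _ a0) -(riesz_lerZ y _ a0) scalerA mulfV// scale1r.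
by rewrite leUl leUr.
Qed.

Lemma riesz_scaleI a x y : 0 <= a -> a *: (x `/\` y) = a *: x `/\` a *: y.
Proof.
by move=> a0; apply: oppr_inj; rewrite riesz_oppI -scalerN riesz_oppI
  riesz_scaleU// !scalerN.
Qed.

Lemma riesz_meetE x y : x `/\` y = x + y - (x `\/` y).
Proof. by apply/eqP; rewrite -(riesz_joinDmeet x y) eq_sym addrC addKr. Qed.

(** Infinite distributivity. If [u] bounds all [x /\ y], then
    [x + y = x \/ y + x /\ y <= s \/ y + u], so that [u + s \/ y - y] bounds [S] and hence [s]. *)
Lemma supremums_meet S s y : supremums S s ->
  supremums [set x `/\` y | x in S] (s `/\` y).
Proof.
move=> [Ss sS]; split=> [_ [x Sx <-]|u uS]; first by rewrite leI2// Ss.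
rewrite riesz_meetE riesz_leBlD -riesz_leBrD; apply: sS => x Sx.
rewrite riesz_leBrD -riesz_joinDmeet addrC; apply: riesz_leD.
  by apply: uS; exists x.
by rewrite leU2// Ss.
Qed.

Lemma supremums2 x y : supremums [set x; y] (x `\/` y).
Proof.
split=> [z [->|->]|u uxy]; rewrite ?leUl ?leUr//.
by rewrite leUx; apply/andP; split; apply: uxy; [left|right].
Qed.

Lemma riesz_meetUl : left_distributive (@Order.meet _ E) (@Order.join _ E).
Proof.
move=> x y z; apply/eqP; rewrite eq_le; apply/andP; split; last first.
  by rewrite leUx !leI2// ?leUl ?leUr.
have [_] := supremums_meet z (supremums2 x y).
by apply => _ [t [->|->] <-]; rewrite ?leUl ?leUr.
Qed.

Lemma riesz_joinIl : left_distributive (@Order.join _ E) (@Order.meet _ E).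
Proof.
move=> x y z; apply: oppr_inj.
by rewrite riesz_oppU !riesz_oppI riesz_meetUl !riesz_oppU.
Qed.

Lemma disjoint_le x y u v : 0 <= x -> 0 <= y -> x <= u -> y <= v ->
  u `/\` v = 0 -> x `/\` y = 0.
Proof.
move=> x0 y0 xu yv uv; apply/eqP; rewrite eq_le riesz_meet_ge0// andbT.
by rewrite -uv leI2.
Qed.

Lemma disjointD x y z : 0 <= x -> 0 <= y -> 0 <= z ->
  x `/\` z = 0 -> y `/\` z = 0 -> (x + y) `/\` z = 0.
Proof.
move=> x0 y0 z0 xz yz; apply/eqP.
rewrite eq_le riesz_meet_ge0 ?riesz_addr_ge0// andbT.
by rewrite (le_trans (riesz_meetD _ _ _))// xz yz addr0.
Qed.

Lemma disjoint_join x y : x `/\` y = 0 -> x `\/` y = x + y.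
Proof. by rewrite -riesz_joinDmeet => ->; rewrite addr0. Qed.

Lemma disjoint_meetD x y z : 0 <= x -> 0 <= y -> 0 <= z -> x `/\` y = 0 ->
  (x + y) `/\` z = x `/\` z + y `/\` z.
Proof.
move=> x0 y0 z0 xy; rewrite -disjoint_join// riesz_meetUl disjoint_join//.
by apply: (disjoint_le _ _ _ _ xy); rewrite ?riesz_meet_ge0// leIl.
Qed.

(** With [m = min 1 a] one has [m (x /\ y) <= (a x) /\ y]. *)
Lemma disjointZ a x y : 0 < a -> 0 <= x -> 0 <= y ->
  (a *: x) `/\` y = 0 -> x `/\` y = 0.
Proof.
move=> a0 x0 y0 xy; pose m := Num.min 1 a.
have m0 : 0 < m by rewrite lt_min ltr01.
apply/eqP; rewrite eq_le riesz_meet_ge0// andbT.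
rewrite -(riesz_lerZ _ _ m0) scaler0 -xy riesz_scaleI ?(ltW m0)//.
apply: leI2; first by rewrite riesz_leZl// ge_min lexx orbT.
by rewrite -[leRHS]scale1r riesz_leZl// ge_min lexx.
Qed.

Definition rpos x : E := x `\/` 0.

Lemma rpos_ge0 x : 0 <= rpos x. Proof. exact: leUr. Qed.

Lemma rpos_ge x : x <= rpos x. Proof. exact: leUl. Qed.

Lemma ler_rpos x y : x <= y -> rpos x <= rpos y.
Proof. by move=> xy; rewrite leU2. Qed.

Lemma rpos_id x : 0 <= x -> rpos x = x.
Proof. by rewrite /rpos => /join_idPl. Qed.

Lemma rpos_le x y : x <= y -> 0 <= y -> rpos x <= y.
Proof. by move=> xy y0; rewrite leUx xy. Qed.

Lemma rpos_le_rabs x : rpos x <= rabs x.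
Proof. by rewrite rpos_le ?rabs_ler ?rabs_ge0. Qed.

Lemma rpos_eq0 x : rpos x = 0 -> x <= 0.
Proof. by move=> <-; exact: rpos_ge. Qed.

Lemma rposI x y : rpos (x `/\` y) = rpos x `/\` rpos y.
Proof. exact: riesz_joinIl. Qed.

Lemma rposN x : rpos (- x) = rpos x - x.
Proof. by rewrite /rpos riesz_joinDr subrr add0r joinC. Qed.

Lemma rposB x : rpos x - rpos (- x) = x.
Proof. by rewrite rposN opprB addrC subrK. Qed.

Lemma rpos_disjoint x : rpos x `/\` rpos (- x) = 0.
Proof.
rewrite rposN -{1}[rpos x]addr0 ![rpos x + _]addrC -riesz_meetDr.
by rewrite -[X in X + _]opprK riesz_oppI oppr0 opprK joinC addNr.
Qed.

Lemma rpos_scale a x : 0 <= a -> rpos (a *: x) = a *: rpos x.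
Proof. by move=> a0; rewrite /rpos riesz_scaleU// scaler0. Qed.

Lemma rposU x y : rpos (x `\/` y) = rpos x `\/` rpos y.
Proof. by rewrite /rpos joinACA joinxx. Qed.

End riesz_arithmetic.

(** * The Archimedean property of Dedekind complete spaces *)

Section riesz_dedekind.
Context {R : realType} {E : rieszSpaceType R}.
Hypothesis hE : dedekind_complete E.
Implicit Types (x y z u v w : E) (a b : R) (S : set E).

(** If [s] is the supremum of the multiples of [w], shifting them by one shows that [s - w] is an
    upper bound as well. *)
Lemma riesz_archimedean w y : (forall n, n%:R *: w <= y) -> w <= 0.
Proof.
move=> wy; have [|s [ss sS]] := hE (S := range (fun n => n%:R *: w)).
  split; first by exists (0%:R *: w), 0%N.
  by exists y => _ [n _ <-].
rewrite -(riesz_lerD2r s) add0r addrC -riesz_leBrD; apply: sS => _ [n _ <-].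
rewrite riesz_leBrD (_ : _ + w = n.+1%:R *: w); first by apply: ss; exists n.+1.
by rewrite -natr1 scalerDl scale1r.
Qed.

Lemma riesz_archimedeanV w y z : (forall n, w <= z + n.+1%:R^-1 *: y) -> w <= z.
Proof.
move=> wy; rewrite -(riesz_lerD2r (- z)) subrr.
(* The positive part of [y] is taken because the multiple by 0 has to be bounded too. *)
apply: (@riesz_archimedean _ (rpos y)) => -[|n].
  by rewrite scale0r rpos_ge0.
rewrite -(riesz_lerZ _ _ (a := n.+1%:R^-1)) ?invr_gt0 ?ltr0n//.
rewrite scalerA mulVf ?pnatr_eq0// scale1r riesz_leBlD addrC.
apply: le_trans (wy n) _; rewrite riesz_lerD2l riesz_lerZ ?rpos_ge//.
Qed.

End riesz_dedekind.
(** * The functional [x |-> phi (|x| /\ e)] and its metric *)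

Lemma geometric_half_sum (R : realType) (n m : nat) :
  \sum_(0 <= k < m) (2^-1 : R) ^+ (n + k) <= 2 * 2^-1 ^+ n.
Proof.
rewrite (_ : \sum_(0 <= k < m) _ = 2 * 2^-1 ^+ n - 2 * 2^-1 ^+ (n + m)).
  by rewrite gerBl mulr_ge0// exprn_ge0// invr_ge0.
elim: m => [|m IH]; first by rewrite big_nil addn0 subrr.
by rewrite big_nat_recr//= IH addnS exprS; lra.
Qed.

Lemma expr_half_lt (R : realType) (eps : R) : 0 < eps ->
  exists n, 2^-1 ^+ n < eps.
Proof.
move=> /ltr_add_invr[k]; rewrite add0r => hk; exists k.+1.
apply: le_lt_trans hk; rewrite exprVn lef_pV2 ?posrE ?exprn_gt0// -natrX ler_nat.
exact/ltnW/ltn_expl.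
Qed.

Global Instance tails_filter (A : directedType) : Filter (tails A).
Proof.
apply: filter_from_filter => [|a b _ _].
  by case: (dle_inhabited A) => a; exists a.
have [c [ac bc]] := dle_directed a b.
by exists c => // x cx; split; [exact: dle_trans ac cx|exact: dle_trans bc cx].
Qed.

(** * Suprema of sequences as suprema of increasing sequences *)

Section partial_joins.
Context {R : realType} {E : rieszSpaceType R}.
Implicit Type z : nat -> E.

Fixpoint partial_join z n : E :=
  if n is m.+1 then partial_join z m `\/` z n else z 0%N.

Lemma partial_join_ub z n k : (k <= n)%N -> z k <= partial_join z n.
Proof.
elim: n => [|n IH]; first by rewrite leqn0 => /eqP ->.
rewrite leq_eqVlt => /predU1P[->|/IH h]; first by rewrite /= leUr.
by rewrite (le_trans h)//= leUl.
Qed.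

Lemma partial_join_homo z m n : (m <= n)%N -> partial_join z m <= partial_join z n.
Proof.
elim: n => [|n IH]; first by rewrite leqn0 => /eqP ->.
rewrite leq_eqVlt => /predU1P[->//|/IH h]; rewrite (le_trans h)//=.
exact: leUl.
Qed.

Lemma partial_join_lub z n u : (forall k, z k <= u) -> partial_join z n <= u.
Proof. by move=> zu; elim: n => [|n IH] //=; rewrite leUx IH zu. Qed.

Lemma supremums_partial_join z s :
  supremums (range z) s -> supremums (range (partial_join z)) s.
Proof.
move=> [zs sz]; split=> [_ [n _ <-]|u uz].
  by apply: partial_join_lub => k; apply: zs; exists k.
apply: sz => _ [n _ <-]; apply: le_trans (partial_join_ub z (leqnn n)) _.
by apply: uz; exists n.
Qed.

End partial_joins.

Section truncated_functional.
Context {R : realType} {E : rieszSpaceType R} {e : E}.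
Variables (he : weak_order_unit e) (phi : {scalar ideal_type (principal_ideal e)}).
Hypothesis phi_pos : strictly_positive phi.
Implicit Types (x y z u v : E) (S : set E).

Definition trunc_fun x : R := phi (truncation he x).
Local Notation F := trunc_fun.
Let e0 : 0 <= e := weak_unit_ge0 he.

Lemma dphiE x y : dphi he phi x y = F (x - y). Proof. by []. Qed.

Lemma trunc_fun_ge0 x : 0 <= F x.
Proof.
apply: (phi_ge0 phi_pos); rewrite ideal_leE /=.
exact: riesz_meet_ge0 (rabs_ge0 _) e0.
Qed.

Lemma trunc_fun_le_trunc x y : rabs x `/\` e <= rabs y `/\` e -> F x <= F y.
Proof. by move=> xy; apply: (phi_le phi_pos); rewrite ideal_leE. Qed.

Lemma trunc_fun_le_rabs x y : rabs x <= rabs y -> F x <= F y.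
Proof. by move=> xy; apply: trunc_fun_le_trunc; rewrite leI2. Qed.

Lemma trunc_fun_le x y : 0 <= x -> x <= y -> F x <= F y.
Proof.
move=> x0 xy; apply: trunc_fun_le_rabs.
by rewrite !ger0_rabs// (le_trans x0).
Qed.

Lemma trunc_fun_trunc x : F (rabs x `/\` e) = F x.
Proof.
have h : 0 <= rabs x `/\` e by exact: riesz_meet_ge0 (rabs_ge0 _) e0.
by congr (phi _); apply: val_inj; rewrite /= ger0_rabs// -meetA meetxx.
Qed.

Lemma trunc_fun0 : F 0 = 0.
Proof. by rewrite -[0](subrr (0 : E)) -dphiE dphixx. Qed.

Lemma trunc_funN x : F (- x) = F x.
Proof. by congr (phi _); apply: val_inj; rewrite /= rabsN. Qed.

Lemma trunc_fun_eq0 x : F x = 0 -> x = 0.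
Proof. by rewrite -[x]subr0 -dphiE => /(dphi_positivity phi_pos) ->; rewrite subr0. Qed.

Lemma trunc_fun_le0 x : F x <= 0 -> x = 0.
Proof.
move=> Fx; apply: trunc_fun_eq0; apply/eqP.
by rewrite eq_le Fx trunc_fun_ge0.
Qed.

Lemma trunc_funD_le x y : F (x + y) <= F x + F y.
Proof.
have := dphi_triangle he phi_pos 0 x (- y).
by rewrite !dphiE opprK subr0 add0r.
Qed.

Lemma trunc_fun_disjointD x y : 0 <= x -> 0 <= y -> x `/\` y = 0 ->
  F (x + y) = F x + F y.
Proof.
move=> x0 y0 xy; rewrite /F -raddfD; congr (phi _); apply: val_inj => /=.
by rewrite !ger0_rabs ?riesz_addr_ge0// disjoint_meetD.
Qed.

Lemma trunc_fun_join_le x y : 0 <= x -> 0 <= y -> F (x `\/` y) <= F x + F y.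
Proof.
move=> x0 y0; apply: le_trans (trunc_funD_le _ _).
apply: trunc_fun_le; first by rewrite (le_trans x0) ?leUl.
by rewrite leUx riesz_lerDl ?riesz_lerDr.
Qed.

(** Induction on the list. The third conclusion is the invariant that makes the next element
    disjoint from the sum so far; 0 belongs to the set in the second one so that the empty sum is a
    supremum as well. *)
Lemma trunc_fun_disjoint_sum (s : seq E) : uniq s ->
  (forall x, x \in s -> 0 <= x) ->
  {in s &, forall x y, x != y -> x `/\` y = 0} ->
  [/\ F (\sum_(x <- s) x) = \sum_(x <- s) F x,
      supremums [set x | x = 0 \/ x \in s] (\sum_(x <- s) x) &
      forall y, 0 <= y -> (forall x, x \in s -> x `/\` y = 0) ->
        (\sum_(x <- s) x) `/\` y = 0].
Proof.
elim: s => [|x s IH] /=.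
  move=> _ _ _; split.
  - by rewrite !big_nil trunc_fun0.
  - rewrite big_nil; split=> [y [->//|]|u uS]; first by rewrite in_nil.
    by apply: uS; left.
  - by move=> y y0 _; rewrite big_nil; apply/meet_idPl.
move=> /andP[xs us] s0 sd.
have {IH}[||IF [IS1 IS2] ID] := IH us.
- by move=> y ys; apply: s0; rewrite in_cons ys orbT.
- by move=> y z ys zs; apply: sd; rewrite in_cons ?ys ?zs orbT.
have x0 : 0 <= x by apply: s0; rewrite mem_head.
have S0 : 0 <= \sum_(x <- s) x by apply: IS1; left.
have dis : x `/\` (\sum_(x <- s) x) = 0.
  rewrite meetC; apply: ID => // y ys; apply: sd; rewrite ?mem_head//.
    by rewrite in_cons ys orbT.
  by apply: contraNneq xs => <-.
rewrite !big_cons; split.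
- by rewrite trunc_fun_disjointD// IF.
- rewrite -disjoint_join//; split=> [y|u uS].
    move=> [->|]; first by rewrite (le_trans x0) ?leUl.
    rewrite in_cons => /predU1P[->|ys]; first exact: leUl.
    by apply: le_trans (leUr _ _); apply: IS1; right.
  rewrite leUx uS; last by right; rewrite mem_head.
  apply: IS2 => y [->|ys]; first by apply: uS; left.
  by apply: uS; right; rewrite in_cons ys orbT.
- move=> y y0 sy; apply: disjointD => //.
    by apply: sy; rewrite mem_head.
  by apply: ID => // z zs; apply: sy; rewrite in_cons zs orbT.
Qed.

Section order_continuity.
Hypothesis phi_oc : order_continuous phi.

(** Order continuity speaks of nets in the ideal. The truncations [y a /\ e] decrease to 0 there,
    since a lower bound of them in the ideal is a lower bound of [y] in [E]. *)
Lemma trunc_fun_cvg0 (A : directedType) (y : A -> E) :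
  decreases_to0 y -> F (y a) @[a --> tails A] --> (0 : R).
Proof.
move=> [yd [y0 yinf]].
have {}y0 a : 0 <= y a by apply: y0; exists a.
apply: (phi_oc (x := fun a => truncation he (y a))).
exists (fun a => truncation he (y a)); split; last first.
  move=> a; rewrite subr0 ger0_rabs// ideal_leE /=.
  exact: riesz_meet_ge0 (rabs_ge0 _) e0.
split=> [a b ab|]; first by rewrite ideal_leE /= !ger0_rabs// leI2// yd.
split=> [_ [a _ <-]|l lS].
  by rewrite ideal_leE /= riesz_meet_ge0 ?rabs_ge0.
rewrite ideal_leE /=; apply: yinf => _ [a _ <-].
have := lS (truncation he (y a)); rewrite ideal_leE /= ger0_rabs//.
by move=> /(_ (ex_intro2 _ _ _ I erefl)); rewrite lexI => /andP[].
Qed.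

Definition nat_directed : directedType.
Proof.
apply: (@DirectedType nat (fun m n => (m <= n)%N)).
- exact: (inhabits 0%N).
- exact: leqnn.
- by move=> b a c; exact: leq_trans.
- by move=> a b; exists (maxn a b); rewrite leq_maxl leq_maxr.
Defined.

Lemma trunc_fun_cvg0_seq (y : nat -> E) : (forall m n, (m <= n)%N -> y n <= y m) ->
  infimums (range y) 0 ->
  forall eps, 0 < eps -> exists N, forall n, (N <= n)%N -> F (y n) < eps.
Proof.
move=> yd y0 eps eps0.
have /cvgrPdist_lt/(_ _ eps0) := @trunc_fun_cvg0 nat_directed y (conj yd y0).
move=> [N _ NF]; exists N => n /NF.
by rewrite /= sub0r normrN ger0_norm// trunc_fun_ge0.
Qed.

Lemma trunc_fun_sup_cvg (z : nat -> E) s :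
  (forall m n, (m <= n)%N -> z m <= z n) -> supremums (range z) s ->
  forall eps, 0 < eps -> exists N, forall n, (N <= n)%N -> F (s - z n) < eps.
Proof.
move=> zi [zs sz]; apply: trunc_fun_cvg0_seq.
  by move=> m n mn; rewrite riesz_lerD2l riesz_leN2 zi.
split=> [_ [n _ <-]|l lS].
  by rewrite riesz_subr_ge0; apply: zs; exists n.
rewrite -(riesz_lerBr_le0 s).
apply: sz => _ [n _ <-]; rewrite riesz_leBrD addrC -riesz_leBrD.
by apply: lS; exists n.
Qed.

Lemma trunc_fun_sup_le (z : nat -> E) s c :
  (forall m n, (m <= n)%N -> z m <= z n) -> supremums (range z) s ->
  (forall n, F (z n) <= c) -> F s <= c.
Proof.
move=> zi zs zc; apply/ler_addgt0Pl => eps eps0.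
have [N NF] := trunc_fun_sup_cvg zi zs eps0.
have /NF /ltW h := leqnn N.
rewrite -[s](subrK (z N)); apply: le_trans (trunc_funD_le _ _) _.
by rewrite lerD// zc.
Qed.

(** Finite subadditivity bounds the values of the partial joins by [c], and order continuity carries
    the bound to their supremum. *)
Lemma trunc_fun_sigma_subadditive (z : nat -> E) s c (b : nat -> R) :
  (forall n, 0 <= z n) -> supremums (range z) s -> (forall n, F (z n) <= b n) ->
  (forall n, \sum_(0 <= k < n) b k <= c) -> F s <= c.
Proof.
move=> z0 /supremums_partial_join zs zb bc.
have pj0 n : 0 <= partial_join z n.
  by elim: n => [|n IH] //=; rewrite (le_trans IH) ?leUl.
apply: trunc_fun_sup_le (partial_join_homo z) zs _ => n.
apply: le_trans (bc n.+1); elim: n => [|n IH] /=; first by rewrite big_nat1.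
rewrite big_nat_recr//=; apply: le_trans (trunc_fun_join_le _ _) _ => //.
by rewrite lerD.
Qed.

(** The finite joins of [S] form an increasing net with supremum [s], so some joins [y n] satisfy
    [F (s - y n) < 1 / (n + 1)]. The elements entering them are countably many; if [u] bounds these,
    the positive part of [s - u] lies below every [s - y n] and is therefore 0. *)
Lemma countable_sup : countable_sup_property E.
Proof.
move=> S s [Ss sS].
pose J y := exists l : seq E, (forall x, x \in l -> S x) /\ supremums [set` l] y.
(* A directed set needs an element; an empty [S] is already countable. *)
have [S0|/set0P S0] := eqVneq S set0.
  by exists S; split=> //; rewrite S0.
have JS x : S x -> J x.
  move=> Sx; exists [:: x]; split=> [y|]; first by rewrite inE => /eqP ->.
  by split=> [y /=|u uS]; [rewrite inE => /eqP ->|apply: uS; rewrite /= inE].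
have JU x y : J x -> J y -> J (x `\/` y).
  move=> [l [lS [l1 l2]]] [k [kS [k1 k2]]]; exists (l ++ k); split.
    by move=> z; rewrite mem_cat => /orP[/lS|/kS].
  split=> [z /=|u uS].
    rewrite mem_cat => /orP[zl|zk].
      by apply: le_trans (leUl _ _); exact: l1.
    by apply: le_trans (leUr _ _); exact: k1.
  rewrite leUx l2 ?k2// => z zl; apply: uS; rewrite /= mem_cat.
    by rewrite zl orbT.
  by rewrite zl.
have Js x : J x -> x <= s.
  by move=> [l [lS [_ l2]]]; apply: l2 => z /lS /Ss.
pose A : directedType := @DirectedType {x | J x} (fun a b => sval a <= sval b)
  (let: ex_intro x Sx := S0 in inhabits (exist J x (JS x Sx)))
  (fun a => lexx _) (fun b a c => @le_trans _ _ _ _ _)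
  (fun a b => ex_intro _ (exist J _ (JU _ _ (svalP a) (svalP b)))
    (conj (leUl _ _) (leUr _ _))).
have yA : decreases_to0 (fun a : A => s - sval a).
  split=> [a b ab|]; first by rewrite riesz_lerD2l riesz_leN2.
  split=> [_ [a _ <-]|l lA]; first by rewrite riesz_subr_ge0 Js//; exact: svalP.
  rewrite -(riesz_lerBr_le0 s).
  apply: sS => x Sx; rewrite riesz_leBrD addrC -riesz_leBrD.
  by apply: lA; exists (exist J x (JS x Sx)).
have /choice[y yP] n : exists y, J y /\ F (s - y) < n.+1%:R^-1.
  have n0 : (0 : R) < n.+1%:R^-1 by rewrite invr_gt0 ltr0n.
  have /cvgrPdist_lt/(_ _ n0)[a _ ha] := trunc_fun_cvg0 yA.
  exists (sval a); split; first exact: svalP.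
  have /ha := dle_refl a.
  by rewrite /= sub0r normrN ger0_norm// trunc_fun_ge0.
have /choice[l lP] n := (yP n).1.
exists (\bigcup_n [set` l n]); split.
- by move=> x [n _ /(lP n).1].
- by apply: bigcup_countable => // n _; exact/finite_set_countable/finite_seq.
- split=> [x [n _ /(lP n).1 /Ss//]|u uS].
  have yu n : y n <= u by apply: (lP n).2.2 => x xl; apply: uS; exists n.
  rewrite -(riesz_lerD2r (- u)) subrr; apply: rpos_eq0; apply: trunc_fun_le0.
  apply/ler_addgt0Pl => eps /ltr_add_invr[k]; rewrite add0r addr0 => /ltW.
  apply: le_trans.
  apply: le_trans (ltW (yP k).2); apply: trunc_fun_le (rpos_ge0 _) _.
  by rewrite rpos_le ?riesz_lerD2l ?riesz_leN2// riesz_subr_ge0 Js//; exact: (yP k).1.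
Qed.

End order_continuity.

Lemma complete_metric_dphiP : complete_metric (metric_dphi he phi_pos) <->
  forall u : nat -> E,
    (forall eps, 0 < eps -> exists N, forall m n, (N <= m)%N -> (N <= n)%N ->
      F (u m - u n) < eps) ->
    exists l, forall eps, 0 < eps -> exists N, forall n, (N <= n)%N -> F (l - u n) < eps.
Proof.
split=> [hc u ucauchy|hc u].
  have [|l /metricType_numDomainType.cvgrPdist_lt ul] := hc u.
    apply/cauchy_exP => eps eps0; have [N NF] := ucauchy _ eps0.
    exists (u N); exists N => // n /= Nn.
    by rewrite ballEmdist /=; exact: NF.
  exists l => eps eps0; have [N _ NF] := ul _ eps0.
  by exists N => n /NF.
move=> /cauchy_ballP ucauchy.
have [|l ul] := hc u.
  move=> eps /ucauchy; rewrite near_map2 => -[[P Q] /= [[N _ NP] [M _ MQ]]] PQ.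
  exists (maxn N M) => m n; rewrite !geq_max => /andP[Nm _] /andP[_ Mn].
  by have := PQ (m, n) (conj (NP _ Nm) (MQ _ Mn)); rewrite /= ballEmdist.
exists l; apply/metricType_numDomainType.cvgrPdist_lt => eps eps0.
by have [N NF] := ul _ eps0; exists N.
Qed.

Lemma open_metric_dphiP (U : set E) : @open (metric_dphi he phi_pos) U <->
  forall x, U x -> exists2 d, 0 < d & forall y, F (x - y) < d -> U y.
Proof.
rewrite openE; split=> UP x Ux.
  have : nbhs (x : metric_dphi he phi_pos) U := UP x Ux.
  by rewrite -metricType_numDomainType.filter_from_mdist_nbhs => -[d d0 dU]; exists d.
rewrite /interior -metricType_numDomainType.filter_from_mdist_nbhs.
by have [d d0 dU] := UP x Ux; exists d.
Qed.

(* Finite subfamilies of [S] whose total value under [trunc_fun] is almost maximal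
   have Cauchy sums; an element of [S] outside all of them has arbitrarily small
   value, hence vanishes. *)
Lemma complete_laterally_complete :
  complete_metric (metric_dphi he phi_pos) -> laterally_complete E.
Proof.
move=> /complete_metric_dphiP hc S S0 Sge0 Sdis.
have dis x y : S x -> S y -> x != y -> x `/\` y = 0.
  move=> Sx Sy /eqP xy; have := Sdis _ _ Sx Sy xy.
  by rewrite /disjoint_elts !ger0_rabs ?Sge0.
pose fam (l : seq E) := uniq l /\ forall x, x \in l -> S x.
pose V (l : seq E) := \sum_(x <- l) F x.
have famP l : fam l -> [/\ F (\sum_(x <- l) x) = V l,
      supremums [set x | x = 0 \/ x \in l] (\sum_(x <- l) x) &
      forall y, 0 <= y -> (forall x, x \in l -> x `/\` y = 0) ->
        (\sum_(x <- l) x) `/\` y = 0].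
  move=> [ul lS]; apply: trunc_fun_disjoint_sum => // [x /lS/Sge0//|].
  by move=> x y /lS Sx /lS Sy; exact: dis.
(* By disjointness [V l] is the value of the sum of [l], whose truncation lies below [e]. *)
have Vle l : fam l -> V l <= F e.
  move=> /famP[<- _ _]; apply: trunc_fun_le_trunc; rewrite (ger0_rabs e0) meetxx.
  exact: leIr.
pose W := [set V l | l in fam].
have hW : has_sup W.
  split; first by exists (V [::]), [::]; split.
  by exists (F e) => _ [l /Vle h <-].
have subV l k : fam l -> fam k -> {subset k <= l} -> V k <= V l.
  move=> [ul _] [uk _] kl.
  have -> : V l = V k + \sum_(x <- l | x \notin k) F x; last first.
    by rewrite lerDl sumr_ge0// => x _; exact: trunc_fun_ge0.
  rewrite [LHS](bigID (mem k))/=; congr (_ + _); rewrite -big_filter; apply: perm_big.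
  apply: uniq_perm => //; first exact: filter_uniq.
  move=> x; rewrite mem_filter; case: (boolP (x \in k)) => //= /kl ->.
  by [].
have /choice[l0 l0P] n : exists l, fam l /\ sup W - 2^-1 ^+ n < V l.
  have n0 : (0 : R) < 2^-1 ^+ n by rewrite exprn_gt0// invr_gt0.
  by have [_ [l fl <-] h] := sup_adherent n0 hW; exists l.
(* The families chosen for [0, ..., n] are merged, so that [L n] increases with [n] while staying
   almost maximal. *)
pose L n := undup (flatten [seq l0 k | k <- iota 0 n.+1]).
have memL n x : x \in L n <-> exists2 k, (k <= n)%N & x \in l0 k.
  rewrite mem_undup; split.
    by move=> /flatten_mapP[k]; rewrite mem_iota add0n ltnS => kn xk; exists k.
  by move=> [k kn xk]; apply/flatten_mapP; exists k => //; rewrite mem_iota add0n ltnS.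
have famL n : fam (L n).
  split; first exact: undup_uniq.
  by move=> x /memL[k _ /(l0P k).1.2].
have VL n : sup W - 2^-1 ^+ n < V (L n).
  apply: lt_le_trans (l0P n).2 _; apply: subV => //; first exact: (l0P n).1.
  by move=> x xl; apply/memL; exists n.
have Wub l : fam l -> V l <= sup W.
  by move=> fl; apply: sup_upper_bound => //; exists l.
pose s n := \sum_(x <- L n) x.
(* The remainder sums the elements of [L n] outside [L m]. Its value is [V (L n) - V (L m)], at most
   [sup W - V (L m) < 2^-m]. *)
have sD m n : (m <= n)%N -> exists r, [/\ 0 <= r, s n = s m + r & F r <= 2^-1 ^+ m].
  move=> mn; pose K := [seq x <- L n | x \notin L m].
  have famK : fam K.
    split; first by rewrite filter_uniq// (famL n).1.
    by move=> x; rewrite mem_filter => /andP[_ /(famL n).2].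
  have [FK [K0 _] _] := famP _ famK.
  have pL : perm_eq (L n) (L m ++ K).
    apply: uniq_perm; first exact: (famL n).1.
      rewrite cat_uniq (famL m).1 famK.1 andbT/=; apply/hasPn => x.
      by rewrite mem_filter => /andP[].
    move=> x; rewrite mem_cat mem_filter; apply/idP/orP => [xn|[/memL[k km xk]|/andP[]//]].
      by case: (boolP (x \in L m)) => xm; [left|right; rewrite xn].
    by apply/memL; exists k => //; exact: leq_trans km mn.
  exists (\sum_(x <- K) x); split.
  - by apply: K0; left.
  - by rewrite /s (perm_big _ pL) big_cat.
  - have : V (L n) = V (L m) + V K by rewrite /V (perm_big _ pL) big_cat.
    by rewrite FK => VE; have := Wub _ (famL n); have := VL m; rewrite VE; lra.
have [|t tP] := hc s.
  move=> eps /expr_half_lt[N hN]; exists N.+1 => m n Nm Nn.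
  have [r [r0 -> Fr]] := sD _ _ Nm; have [q [q0 -> Fq]] := sD _ _ Nn.
  rewrite opprD addrACA subrr add0r; apply: le_lt_trans hN.
  apply: le_trans (trunc_funD_le _ _) _; rewrite trunc_funN.
  by move: Fr Fq; rewrite exprS; lra.
(* For [m >= n] the positive part of [s n - t] is at most [|t - s m|], whose value can be made
   arbitrarily small. *)
have s_t n : s n <= t.
  rewrite -(riesz_lerD2r (- t)) subrr; apply: rpos_eq0; apply: trunc_fun_le0.
  apply/ler_addgt0Pl => eps /tP[N NF]; rewrite addr0.
  have [r [r0 sr _]] := sD _ _ (leq_maxr N n).
  apply: le_trans (ltW (NF _ (leq_maxl N n))).
  apply: trunc_fun_le_rabs; rewrite ger0_rabs ?rpos_ge0// rabsB.
  apply: le_trans (rpos_le_rabs _); apply: ler_rpos.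
  by rewrite riesz_lerD2r sr riesz_lerDl.
have s0 n : 0 <= s n by have [_ [h _] _] := famP _ (famL n); apply: h; left.
exists t; split=> [x Sx|u uS].
  have [[n xn]|xL] := pselect (exists n, x \in L n).
    apply: le_trans (s_t n); have [_ [h _] _] := famP _ (famL n).
    by apply: h; right.
  suff -> : x = 0 by exact: le_trans (s0 0%N) (s_t _).
  apply: trunc_fun_le0; apply/ler_addgt0Pl => eps /expr_half_lt[n hn]; rewrite addr0.
  have /Wub : fam (x :: L n).
    split=> [|y].
      by rewrite /= (famL n).1 andbT; apply/negP => xn; apply: xL; exists n.
    by rewrite in_cons => /predU1P[->//|/(famL n).2].
  by rewrite /V big_cons => h; have := VL n; rewrite /V; move: hn; lra.
have u0 : 0 <= u by have [x Sx] := S0; exact: le_trans (Sge0 _ Sx) (uS _ Sx).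
have su n : s n <= u.
  have [_ [_ h] _] := famP _ (famL n); apply: h => y [->//|/(famL n).2].
  exact: uS.
rewrite -(riesz_lerD2r (- u)) subrr; apply: rpos_eq0; apply: trunc_fun_le0.
apply/ler_addgt0Pl => eps /tP[N NF]; rewrite addr0.
apply: le_trans (ltW (NF _ (leqnn N))).
apply: trunc_fun_le_rabs; rewrite ger0_rabs ?rpos_ge0//.
apply: le_trans (rpos_le_rabs _); apply: ler_rpos.
by rewrite riesz_lerD2l riesz_leN2.
Qed.

End truncated_functional.

(** * Comparison of two functionals and of their topologies *)

Section comparison.
Context {R : realType} {E : rieszSpaceType R} {e : E}.
Hypothesis hE : dedekind_complete E.
Variable he : weak_order_unit e.
Implicit Types phi psi : {scalar ideal_type (principal_ideal e)}.
Let e0 : 0 <= e := weak_unit_ge0 he.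

(* If [phi (z n) <= 2^-n], the tails [w n] of the suprema of the [z n] decrease
   to an element killed by [phi], hence to [0], so that [psi (w n)] tends to [0]. *)
Lemma trunc_fun_continuous phi psi :
  strictly_positive phi -> order_continuous phi ->
  strictly_positive psi -> order_continuous psi ->
  forall eps, 0 < eps -> exists2 d, 0 < d &
    forall x, trunc_fun he phi x < d -> trunc_fun he psi x < eps.
Proof.
move=> phi_pos phi_oc psi_pos psi_oc eps eps0; apply: contrapT => hN.
have /choice[z' zP'] n : exists x, trunc_fun he phi x < 2^-1 ^+ n /\
    eps <= trunc_fun he psi x.
  apply: contrapT => hn; apply: hN; exists (2^-1 ^+ n).
    by rewrite exprn_gt0// invr_gt0.
  by move=> x xn; rewrite ltNge; apply/negP => h; apply: hn; exists x.
(* Truncation leaves both values unchanged and bounds the sequence by [e], so that the suprema of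
   its tails exist. *)
pose z n := rabs (z' n) `/\` e.
have z0 n : 0 <= z n by exact: riesz_meet_ge0 (rabs_ge0 _) e0.
have zP n : trunc_fun he phi (z n) < 2^-1 ^+ n /\ eps <= trunc_fun he psi (z n).
  by rewrite !trunc_fun_trunc; exact: zP'.
have /choice[w wP] n : exists w, supremums (range (fun k => z (n + k)%N)) w.
  apply: hE; split; first by exists (z (n + 0)%N), 0%N.
  by exists e => _ [k _ <-]; exact: leIr.
have zw n k : (n <= k)%N -> z k <= w n.
  by move=> /subnKC <-; apply: (wP n).1; exists (k - n)%N.
have wd m n : (m <= n)%N -> w n <= w m.
  move=> mn; apply: (wP n).2 => _ [k _ <-]; apply: zw.
  exact: leq_trans mn (leq_addr _ _).
have w0 n : 0 <= w n by exact: le_trans (z0 n) (zw _ _ (leqnn n)).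
have wphi n : trunc_fun he phi (w n) <= 2 * 2^-1 ^+ n.
  apply: (trunc_fun_sigma_subadditive _ phi_oc _ (wP n)
    (b := fun k => 2^-1 ^+ (n + k))) => // k; first exact/ltW/(zP _).1.
  exact: geometric_half_sum.
have winf : infimums (range w) 0.
  split=> [_ [n _ <-]//|l lw]; apply: rpos_eq0.
  apply: (@trunc_fun_le0 _ _ _ he _ phi_pos); apply/ler_addgt0Pl => d d0.
  have /expr_half_lt[n hn] : 0 < d / 2 by rewrite divr_gt0.
  apply: (@le_trans _ _ (trunc_fun he phi (w n))); last by have := wphi n; lra.
  apply: trunc_fun_le (rpos_ge0 _) _ => //; rewrite rpos_le//.
  by apply: lw; exists n.
have [N NF] := trunc_fun_cvg0_seq he psi_pos psi_oc wd winf eps0.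
have := NF _ (leqnn N); rewrite ltNge => /negP; apply.
by apply: le_trans (zP N).2 _; apply: trunc_fun_le => //; exact: zw.
Qed.

(** Both metrics are translation invariant, so comparing balls around 0 in the two directions is
    enough. *)
Lemma open_metric_dphi_eq phi psi (hphi : strictly_positive phi)
    (hpsi : strictly_positive psi) :
  order_continuous phi -> order_continuous psi ->
  (@open (metric_dphi he hphi) : set (set E)) = @open (metric_dphi he hpsi).
Proof.
move=> phi_oc psi_oc; apply/seteqP; split=> U /open_metric_dphiP UP;
  apply/open_metric_dphiP => x /UP[d d0 dU].
  have [c c0 cd] := trunc_fun_continuous hpsi psi_oc hphi phi_oc d0.
  by exists c => // y /cd /dU.
have [c c0 cd] := trunc_fun_continuous hphi phi_oc hpsi psi_oc d0.
by exists c => // y /cd /dU.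
Qed.

End comparison.
(** * Components of the weak unit *)

Section components.
Context {R : realType} {E : rieszSpaceType R} {e : E}.
Hypothesis e0 : 0 <= e.
Implicit Types (x y z u v p q a : E).

(** In a space of functions with [e = 1] these are the indicator functions; they form a Boolean
    algebra with complement [e - p]. *)
Definition component p := p `/\` (e - p) = 0.

Lemma component_ge0 p : component p -> 0 <= p.
Proof. by move=> <-; exact: leIl. Qed.

Lemma component_le p : component p -> p <= e.
Proof. by rewrite -riesz_subr_ge0 => <-; exact: leIr. Qed.

Lemma componentB p : component p -> component (e - p).
Proof. by rewrite /component subKr meetC. Qed.

Lemma component0 : component 0.
Proof. by rewrite /component subr0; apply/meet_idPl. Qed.

Lemma component1 : component e.
Proof. by rewrite -[e]subr0; apply: componentB; exact: component0. Qed.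

Lemma subcomponent_ge0 p : component p -> 0 <= e - p.
Proof. by move=> /componentB/component_ge0. Qed.

Lemma componentI p q : component p -> component q -> component (p `/\` q).
Proof.
move=> cp cq; rewrite /component meetC.
have [p0 q0] := (component_ge0 cp, component_ge0 cq).
have pq0 : 0 <= p `/\` q by exact: riesz_meet_ge0.
rewrite riesz_oppI [e + _]addrC riesz_joinDr ![_ + e]addrC.
apply: (@disjoint_le _ _ _ _ ((e - p) + (e - q)) (p `/\` q)) => //.
- by rewrite (le_trans (subcomponent_ge0 cp)) ?leUl.
- by rewrite leUx riesz_lerDl ?riesz_lerDr ?subcomponent_ge0.
- apply: disjointD => //; rewrite ?subcomponent_ge0//; rewrite meetC.
    exact: disjoint_le pq0 (subcomponent_ge0 cp) (leIl _ _) (lexx _) cp.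
  exact: disjoint_le pq0 (subcomponent_ge0 cq) (leIr _ _) (lexx _) cq.
Qed.

Lemma component_subU p q : e - (p `\/` q) = (e - p) `/\` (e - q).
Proof. by rewrite riesz_oppU [e + _]addrC riesz_meetDr ![_ + e]addrC. Qed.

Lemma componentU p q : component p -> component q -> component (p `\/` q).
Proof.
move=> /componentB cp /componentB cq.
rewrite -[_ `\/` _](subKr e) component_subU.
by apply: componentB; exact: componentI.
Qed.

(** Since [q = (p + (e - p)) /\ q <= p /\ q + (e - p) /\ q], the part of [q] outside [p] is the
    obstruction. Inequalities thus become disjointness, which passes to suprema. *)
Lemma le_componentP q p : component p -> 0 <= q -> q <= e ->
  (q <= p) <-> q `/\` (e - p) = 0.
Proof.
move=> cp q0 qe; split=> [qp|qd].
  exact: (disjoint_le q0 (subcomponent_ge0 cp) qp (lexx _) cp).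
have -> : q = (p + (e - p)) `/\` q.
  by rewrite addrC subrK; apply/esym/meet_idPr.
have [p0 ep0] := (component_ge0 cp, subcomponent_ge0 cp).
rewrite (le_trans (riesz_meetD p0 ep0 q0))//.
by rewrite [(e - p) `/\` q]meetC qd addr0 leIl.
Qed.

Lemma supremums_disjoint (S : set E) s a : 0 <= a -> 0 <= s -> supremums S s ->
  (forall x, S x -> x `/\` a = 0) -> s `/\` a = 0.
Proof.
move=> a0 s0 Ss Sa; apply/eqP; rewrite eq_le riesz_meet_ge0// andbT.
have [_] := supremums_meet a Ss.
by apply => _ [x /Sa <- <-].
Qed.

Lemma component_sup (S : set E) s : S !=set0 -> (forall p, S p -> component p) ->
  supremums S s -> component s.
Proof.
move=> [p0 Sp0] cS Ss.
have s0 : 0 <= s by apply: le_trans (Ss.1 _ Sp0); exact/component_ge0/cS.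
have se : s <= e by apply: Ss.2 => p /cS/component_le.
apply: supremums_disjoint (Ss) _ => //; first by rewrite riesz_subr_ge0.
move=> p Sp; apply: disjoint_le (cS _ Sp) => //.
- exact/component_ge0/cS.
- by rewrite riesz_subr_ge0.
- by rewrite riesz_lerD2l riesz_leN2; exact: Ss.1.
Qed.

Lemma component_disjoint_sum (p : nat -> E) (S := fun n => \sum_(0 <= k < n) p k) :
  (forall n, component (p n)) -> (forall m n, m != n -> p m `/\` p n = 0) ->
  forall n, component (S n) /\ forall m, (n <= m)%N -> S n `/\` p m = 0.
Proof.
move=> cp dp; have p0 n := component_ge0 (cp n).
elim=> [|n [IHc IHd]].
  rewrite /S big_nil; split=> [|m _]; first exact: component0.
  exact/meet_idPl.
rewrite /S big_nat_recr//= -/(S n); split=> [|m nm].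
  by rewrite -disjoint_join ?IHd//; exact: componentU.
apply: disjointD => //; first exact: component_ge0.
  by rewrite IHd// ltnW.
by rewrite dp// neq_ltn nm.
Qed.

End components.

(** * Carriers: the component on which an element is positive *)

Section carriers.
Context {R : realType} {E : rieszSpaceType R} {e : E}.
Hypotheses (hE : dedekind_complete E) (he : weak_order_unit e).
Implicit Types (x y z u v p q a d : E) (s t : R).
Let e0 : 0 <= e := weak_unit_ge0 he.
Local Notation component := (@component R E e).

(* The component of [e] in the band generated by [rpos u]. *)
Definition carrier d u : E :=
  xget 0 (supremums (range (fun n => (n%:R *: rpos u) `/\` d))).
Local Notation car := (carrier e).

Lemma carrierP u : supremums (range (fun n => (n%:R *: rpos u) `/\` e)) (car u).
Proof.
have [|s ss] := hE (S := range (fun n => (n%:R *: rpos u) `/\` e)).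
  split; first by exists (0%:R *: rpos u `/\` e), 0%N.
  by exists e => _ [n _ <-]; exact: leIr.
exact: (xgetI _ ss).
Qed.

Lemma carrier_ge0 u : 0 <= car u.
Proof.
have := (carrierP u).1 _ (ex_intro2 _ _ 0%N I erefl).
by rewrite scale0r (meet_idPl e0).
Qed.

Lemma carrier_le u : car u <= e.
Proof. by apply: (carrierP u).2 => _ [n _ <-]; exact: leIr. Qed.

Lemma disjoint_unit_eq0 x : 0 <= x -> x `/\` e = 0 -> x = 0.
Proof. by move=> x0 xe; apply: (weak_unit_disjoint he); rewrite ger0_rabs. Qed.

(** Disjointness determines a component, so most properties of carriers follow from this
    equivalence. From left to right [a /\ rpos u] is disjoint from [e], hence 0 because [e] is a
    weak unit; from right to left disjointness passes to the multiples of [rpos u] and to the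
    supremum. *)
Lemma carrier_disjointP a u : 0 <= a ->
  a `/\` car u = 0 <-> a `/\` rpos u = 0.
Proof.
move=> a0; split=> au.
  apply: disjoint_unit_eq0; first by rewrite riesz_meet_ge0 ?rpos_ge0.
  rewrite -meetA; apply: disjoint_le au => //.
    by rewrite riesz_meet_ge0 ?rpos_ge0.
  have := (carrierP u).1 _ (ex_intro2 _ _ 1%N I erefl).
  by rewrite scale1r.
rewrite meetC; apply: supremums_disjoint (carrierP u) _ => //.
  exact: carrier_ge0.
move=> _ [n _ <-]; apply: (@disjoint_le _ _ _ _ (n%:R *: rpos u) a) => //.
- by rewrite riesz_meet_ge0// riesz_scale_ge0 ?rpos_ge0.
- exact: leIl.
case: n => [|n]; first by rewrite scale0r; apply/meet_idPl.
apply: (@disjointZ _ _ (n.+1%:R^-1)); rewrite ?invr_gt0 ?ltr0n//.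
  by rewrite riesz_scale_ge0 ?rpos_ge0.
by rewrite scalerA mulVf ?pnatr_eq0// scale1r meetC.
Qed.

(** For [w = (e - car u) /\ rpos u], induction gives [n w <= car u]: then [(n + 1) w] is below
    [car u + (e - car u) = e] and below [(n + 1) rpos u], hence below [car u]. The Archimedean
    property yields [w = 0]. *)
Lemma carrier_component u : component (car u).
Proof.
rewrite /component meetC; apply/carrier_disjointP.
  by rewrite riesz_subr_ge0 carrier_le.
set w := _ `/\` _.
have w0 : 0 <= w by rewrite riesz_meet_ge0 ?rpos_ge0 ?riesz_subr_ge0 ?carrier_le.
have hw n : n%:R *: w <= car u.
  elim: n => [|n IH]; first by rewrite scale0r carrier_ge0.
  apply: (@le_trans _ _ ((n.+1%:R *: rpos u) `/\` e)); last first.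
    by apply: (carrierP u).1; exists n.+1.
  rewrite lexI riesz_leZ ?leIr//= -natr1 scalerDl scale1r.
  by rewrite -riesz_leBrD (le_trans IH)// riesz_leBrD addrC -riesz_leBrD leIl.
by apply/eqP; rewrite eq_le w0 andbT; exact: riesz_archimedean hw.
Qed.

Lemma carrier_disjointC u : rpos u `/\` (e - car u) = 0.
Proof.
rewrite meetC; apply/carrier_disjointP; first by rewrite riesz_subr_ge0 carrier_le.
by rewrite meetC; exact: carrier_component.
Qed.

Lemma carrier_leP u p : component p -> car u <= p <-> rpos u `/\` (e - p) = 0.
Proof.
move=> cp; rewrite (le_componentP cp) ?carrier_ge0 ?carrier_le//.
rewrite meetC carrier_disjointP ?subcomponent_ge0//.
by rewrite meetC.
Qed.

Lemma ler_carrier u v : rpos u <= rpos v -> car u <= car v.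
Proof.
move=> uv; apply/carrier_leP; first exact: carrier_component.
apply: disjoint_le (carrier_disjointC v) => //; first exact: rpos_ge0.
by rewrite riesz_subr_ge0 carrier_le.
Qed.

Lemma carrierI u v : car (u `/\` v) = car u `/\` car v.
Proof.
apply/eqP; rewrite eq_le lexI !ler_carrier ?ler_rpos ?leIl ?leIr//=.
set r := car (u `/\` v).
have cr : component r by exact: carrier_component.
have r0 : 0 <= e - r by exact: subcomponent_ge0.
have pu : 0 <= rpos u by exact: rpos_ge0.
apply/(le_componentP cr) => //.
- by rewrite riesz_meet_ge0 ?carrier_ge0.
- by rewrite (le_trans (leIl _ _)) ?carrier_le.
have -> : (car u `/\` car v) `/\` (e - r) = ((e - r) `/\` car v) `/\` car u.
  by rewrite meetC -[RHS]meetA [car v `/\` _]meetC.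
apply/carrier_disjointP; first by rewrite riesz_meet_ge0 ?carrier_ge0.
have -> : ((e - r) `/\` car v) `/\` rpos u = ((e - r) `/\` rpos u) `/\` car v.
  by rewrite meetAC.
apply/carrier_disjointP; first by rewrite riesz_meet_ge0.
by rewrite -meetA -rposI meetC; exact: carrier_disjointC.
Qed.

Lemma carrierU u v : car (u `\/` v) = car u `\/` car v.
Proof.
apply/eqP; rewrite eq_le leUx !ler_carrier ?ler_rpos ?leUl ?leUr//= andbT.
have cuv : component (car u `\/` car v).
  by apply: componentU => //; exact: carrier_component.
have h w : car w <= car u `\/` car v -> rpos w `/\` (e - (car u `\/` car v)) = 0.
  by move=> wuv; apply/carrier_leP.
apply/carrier_leP => //; rewrite rposU riesz_meetUl h ?leUl// h ?leUr//.
exact: joinxx.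
Qed.

Lemma carrier_eq0 u : u <= 0 -> car u = 0.
Proof.
move=> u0; apply/eqP; rewrite eq_le carrier_ge0 andbT.
apply/carrier_leP; first exact: component0.
by rewrite /rpos (join_idPr u0) subr0; apply/meet_idPl.
Qed.

Lemma carrier_eq0_le u : car u = 0 -> u <= 0.
Proof.
move=> cu; apply: rpos_eq0; apply: disjoint_unit_eq0; first exact: rpos_ge0.
rewrite meetC; apply/carrier_disjointP => //.
by rewrite cu; apply/meet_idPr.
Qed.

Lemma carrierZ s u : 0 < s -> car (s *: u) = car u.
Proof.
have key t v : 0 < t -> car v <= car (t *: v).
  move=> t0; apply/carrier_leP; first exact: carrier_component.
  apply: (disjointZ t0); rewrite ?rpos_ge0 ?subcomponent_ge0//.
    exact: carrier_component.
  rewrite -rpos_scale ?ltW//; exact: carrier_disjointC.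
move=> s0; apply/eqP; rewrite eq_le key// andbT.
have := key s^-1 (s *: u); rewrite scalerA mulVf ?gt_eqF// scale1r.
by apply; rewrite invr_gt0.
Qed.

Lemma carrier_component_id p : component p -> car p = p.
Proof.
move=> cp; have p0 := component_ge0 cp.
apply/eqP; rewrite eq_le; apply/andP; split.
  by apply/carrier_leP => //; rewrite rpos_id.
apply/(le_componentP (carrier_component p)) => //; first exact: component_le.
by have := carrier_disjointC p; rewrite rpos_id.
Qed.

Lemma carrier_unit : car e = e.
Proof. by apply: carrier_component_id; exact: component1. Qed.

(** Where [u] and [v] are both positive, so is their sum: [u + v >= 2 (u /\ v)]. *)
Lemma carrierD u v : car u `/\` car v <= car (u + v).
Proof.
rewrite -carrierI; apply: ler_carrier.
have m0 : 0 <= rpos (u `/\` v) by exact: rpos_ge0.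
apply: (le_trans (riesz_lerDl _ m0)); rewrite -mulr2n -scaler_nat.
rewrite -rpos_scale// scaler_nat mulr2n; apply: ler_rpos.
by apply: riesz_leD; [exact: leIl|exact: leIr].
Qed.

Lemma carrier_opp_disjoint u : car u `/\` car (- u) = 0.
Proof.
rewrite -carrierI; apply: carrier_eq0; apply: rpos_eq0.
by rewrite rposI rpos_disjoint.
Qed.

(** Where the sum is positive, one of the terms is: [s e <= u + v <= 2 (u \/ v)]. *)
Lemma carrier_join_unit u v s : 0 < s -> s *: e <= u + v -> car u `\/` car v = e.
Proof.
move=> s0 suv; apply/eqP; rewrite -carrierU eq_le carrier_le/=.
rewrite -{1}carrier_unit -(carrierZ _ s0).
have -> : car (u `\/` v) = car (2 *: (u `\/` v)) by rewrite carrierZ// ltr0n.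
apply: ler_carrier; apply: ler_rpos; apply: (le_trans suv).
by rewrite scaler_nat mulr2n; apply: riesz_leD; [exact: leUl|exact: leUr].
Qed.

(* [w] is disjoint from [rpos (e - x / n)], and [e <= rpos (e - x / n) + rpos x / n],
   so that [w <= rpos x / n]. *)
Lemma carrier_inf0 x w : 0 <= w -> (forall n, w <= car (x - n.+1%:R *: e)) -> w = 0.
Proof.
move=> w0 wx.
have we : w <= e by exact: le_trans (wx 0%N) (carrier_le _).
apply/eqP; rewrite eq_le w0 andbT.
apply: (riesz_archimedeanV hE (y := rpos x)) => n; rewrite add0r.
set c : R := n.+1%:R^-1.
have c0 : 0 < c by rewrite invr_gt0 ltr0n.
pose y := rpos (e - c *: x).
have wy : w `/\` y = 0.
  apply/carrier_disjointP => //.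
  apply: disjoint_le (carrier_opp_disjoint (x - n.+1%:R *: e)) => //.
    exact: carrier_ge0.
  rewrite -(carrierZ (- _) c0) opprB scalerBr scalerA mulVf ?pnatr_eq0//.
  by rewrite scale1r.
have ey : e <= y + c *: rpos x.
  rewrite -riesz_leBlD -rpos_scale ?(ltW c0)//; apply: le_trans (rpos_ge _).
  by rewrite riesz_lerD2l riesz_leN2 rpos_ge.
have cx0 : 0 <= c *: rpos x by rewrite riesz_scale_ge0 ?rpos_ge0 ?ltW.
have -> : w = (y + c *: rpos x) `/\` w by apply/esym/meet_idPr; exact: le_trans we ey.
apply: le_trans (riesz_meetD (rpos_ge0 _) cx0 w0) _.
by rewrite meetC wy add0r leIl.
Qed.

Lemma carrier_pos_neq0 x : ~ (x <= 0) -> exists n, car (x - n.+1%:R^-1 *: e) <> 0.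
Proof.
move=> x0; apply: contrapT => h; apply: x0.
apply: (riesz_archimedeanV hE (y := e)) => n; rewrite add0r.
rewrite -(riesz_lerD2r (- (n.+1%:R^-1 *: e))) subrr.
by apply: carrier_eq0_le; apply: contrapT => hn; apply: h; exists n.
Qed.

End carriers.
(** * The Stone space of the components *)

Section stone_points.
Context {R : realType} {E : rieszSpaceType R} {e : E}.
Implicit Types (p q r : E) (w : set E).
Local Notation component := (@component R E e).

Definition ultrafilter w := [/\ w `<=` component, ~ w 0,
  (forall p q, w p -> w q -> w (p `/\` q)),
  (forall p q, w p -> component q -> p <= q -> w q) &
  (forall p, component p -> w p \/ w (e - p))].

(** Zorn's lemma is applied to families of components that are closed under meets and whose members
    all meet [r]. Upward closure and the dichotomy between [p] and [e - p] are not imposed but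
    follow from maximality. *)
Lemma ultrafilter_exists r : component r -> r <> 0 ->
  exists2 w, ultrafilter w & w r.
Proof.
move=> cr r0.
pose P (A : set E) := [/\ A `<=` component,
  (forall p q, A p -> A q -> A (p `/\` q)) &
  (forall p, A p -> p `/\` r <> 0)].
have [F FP Ftot|A [[Ac AI Ar] Amax]] := @Zorn_bigcup E P.
  split=> [p [B FB Bp]|p q [B FB Bp] [C FC Cq]|p [B FB Bp]].
  - by have [+ _ _] := FP _ FB; exact.
  - have [BC|CB] := Ftot _ _ FB FC.
      by exists C => //; have [_ + _] := FP _ FC; apply=> //; exact: BC.
    by exists B => //; have [_ + _] := FP _ FB; apply=> //; exact: CB.
  - by have [_ _] := FP _ FB; exact.
(* Adjoining [p] and all meets [a /\ p] gives an admissible family, strictly larger unless [p] is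
   already a member. *)
have key p : component p -> p `/\` r <> 0 ->
    (forall a, A a -> (a `/\` p) `/\` r <> 0) -> A p.
  move=> cp pr apr; apply: contrapT => Ap.
  pose B := A `|` ([set p] `|` [set a `/\` p | a in A]).
  apply: (Amax B).
    split; first by move=> x Ax; left.
    by move=> BA; apply: Ap; apply: BA; right; left.
  split=> [x [/Ac//|[->//|[a /Ac ca <-]]]|x y|x].
  - exact: componentI.
  - move=> [Ax|[->|[a Aa <-]]] [Ay|[->|[b Ab <-]]].
    + by left; exact: AI.
    + by right; right; exists x.
    + by right; right; exists (x `/\` b); rewrite ?meetA//; exact: AI.
    + by right; right; exists y; rewrite 1?meetC.
    + by right; left; rewrite meetxx.
    + by right; right; exists b => //; rewrite meetCA meetxx.
    + by right; right; exists (a `/\` y); [exact: AI|rewrite meetAC].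
    + by right; right; exists a => //; rewrite -meetA meetxx.
    + right; right; exists (a `/\` b); first exact: AI.
      by rewrite meetACA meetxx.
  - by move=> [/Ar//|[->//|[a /apr + <-]]].
have Arr : A r.
  by apply: key => //; rewrite ?meetxx// => a /Ar; rewrite -meetA meetxx.
exists A => //; split=> //.
- by move=> /Ar; apply; exact/meet_idPl/(component_ge0 cr).
- move=> p q Ap cq pq; have hq a : A a -> (a `/\` q) `/\` r <> 0.
    move=> Aa h; apply: (Ar (a `/\` p)); first exact: AI.
    have ap0 := component_ge0 (Ac _ (AI _ _ Aa Ap)).
    apply/eqP; rewrite eq_le riesz_meet_ge0 ?(component_ge0 cr)// andbT.
    by rewrite -h !leI2.
  apply: key => // qr; apply: (hq r) => //.
  by rewrite meetC meetA meetxx meetC.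
- move=> p cp; apply: contrapT => /not_orP[Ap Aep].
  (* A component left out is disjoint from some member. If [a] and [b] are members disjoint from [p]
     and from [e - p], then [a /\ b] lies below [p] and is 0, although it must meet [r]. *)
  have hp q : component q -> ~ A q -> exists2 a, A a & a `/\` q = 0.
    move=> cq Aq; apply: contrapT => hN; apply: Aq.
    have h a : A a -> (a `/\` q) `/\` r <> 0.
      move=> Aa h; apply: hN; exists (a `/\` r); first exact: AI.
      by rewrite meetAC.
    apply: key => // qr; apply: (h r) => //.
    by rewrite meetC meetA meetxx meetC.
  have [a Aa ap] := hp _ cp Ap; have [b Ab bp] := hp _ (componentB cp) Aep.
  have Aab := AI _ _ Aa Ab.
  have cab := Ac _ Aab; have ab0 := component_ge0 cab.
  have h : a `/\` b <= p.
    apply/(le_componentP cp) => //; first exact: component_le.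
    apply: disjoint_le bp => //; [exact: subcomponent_ge0|exact: leIr].
  apply: (Ar _ Aab); suff -> : a `/\` b = 0 by exact/meet_idPl/(component_ge0 cr).
  by rewrite -(meet_idPl h) meetAC ap; exact/meet_idPl/(component_ge0 (Ac _ Ab)).
Qed.

End stone_points.

Section stone_space.
Context {R : realType} {E : rieszSpaceType R} {e : E}.
Context {hE : dedekind_complete E} {he : weak_order_unit e}.
Context {phi : {scalar ideal_type (principal_ideal e)}}.
Context {phi_pos : strictly_positive phi} {phi_oc : order_continuous phi}.
Implicit Types (p q r s : E).
Let e0 : 0 <= e := weak_unit_ge0 he.
Local Notation component := (@component R E e).
Local Notation F := (trunc_fun he phi).

(* The arguments only serve to attach a sigma-algebra and a measure to the type. *)
Definition stone (_ : dedekind_complete E) (f : {scalar ideal_type (principal_ideal e)})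
  (_ : weak_order_unit e) (_ : strictly_positive f) (_ : order_continuous f) : Type :=
  {w : set E | @ultrafilter R E e w}.
Local Notation X := (stone hE he phi_pos phi_oc).
Implicit Types (w : X) (A N : set X).

Lemma stone_inhabited : exists w : X, sval w e.
Proof.
have [|w uw we] := @ultrafilter_exists _ _ _ _ (component1 e0).
  by move=> e_eq0; have := he.1; rewrite e_eq0 ltxx.
by exists (exist _ w uw).
Qed.

HB.instance Definition _ := gen_eqMixin X.
HB.instance Definition _ := gen_choiceMixin X.
HB.instance Definition _ := isPointed.Build X (sval (cid stone_inhabited)).

Definition stone_set p : set X := [set w | sval w p].

Lemma stone_set_neq0 p : component p -> p <> 0 -> exists w, stone_set p w.
Proof.
move=> cp p0; have [w uw wp] := ultrafilter_exists cp p0.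
by exists (exist _ w uw).
Qed.

Lemma stone_set0 w : ~ stone_set 0 w.
Proof. by have [] := svalP w. Qed.

Lemma stone_set_le p q w : component q -> p <= q -> stone_set p w -> stone_set q w.
Proof. by have [_ _ _ h _] := svalP w => cq pq wp; exact: h wp cq pq. Qed.

Lemma stone_setI p q w : component p -> component q ->
  stone_set (p `/\` q) w <-> stone_set p w /\ stone_set q w.
Proof.
move=> cp cq; split=> [pq|[wp wq]].
  by split; [apply: stone_set_le (leIl _ _) pq|apply: stone_set_le (leIr _ _) pq].
by have [_ _ h _ _] := svalP w; exact: h.
Qed.

Lemma stone_setC p w : component p -> stone_set (e - p) w <-> ~ stone_set p w.
Proof.
move=> cp; split=> [wNp wp|wp].
  have /(stone_setI _ cp (componentB cp)) : stone_set p w /\ stone_set (e - p) w by [].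
  by rewrite (cp : p `/\` _ = 0); exact: stone_set0.
by have [_ _ _ _ /(_ _ cp)[]] := svalP w.
Qed.

Lemma stone_set1 w : stone_set e w.
Proof.
rewrite -[e]subr0; apply/(stone_setC _ (component0 e0)); exact: stone_set0.
Qed.

Lemma stone_setU p q w : component p -> component q ->
  stone_set (p `\/` q) w <-> stone_set p w \/ stone_set q w.
Proof.
move=> cp cq; have cpq := componentU cp cq.
have h : stone_set (e - (p `\/` q)) w <-> ~ stone_set p w /\ ~ stone_set q w.
  rewrite component_subU stone_setI; [|exact: componentB..].
  by rewrite !stone_setC.
move: h; rewrite stone_setC// => h; split=> [wpq|wpq].
  by apply: contrapT => /not_orP /h.
by apply: contrapT => /h [wp wq]; case: wpq.
Qed.

Lemma stone_set_sub p q : component p -> component q ->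
  stone_set p `<=` stone_set q -> p <= q.
Proof.
move=> cp cq pq; apply/(le_componentP cq (component_ge0 cp) (component_le cp)).
have cpq : component (p `/\` (e - q)) by apply: componentI => //; exact: componentB.
apply: contrapT => /(stone_set_neq0 cpq)[w /(stone_setI _ cp (componentB cq))[/pq wq]].
by rewrite stone_setC.
Qed.

(* In the Stone space of a measure algebra the null sets are nowhere dense, so that
   a single component suffices where an outer measure would use countable covers. *)
Definition null N := forall eps : R, 0 < eps ->
  exists q, [/\ component q, N `<=` stone_set q & F q < eps].

Lemma null_sub N N' : N `<=` N' -> null N' -> null N.
Proof.
move=> NN nN eps /nN[q [cq Nq Fq]]; exists q; split=> //.
exact: subset_trans Nq.
Qed.

Lemma null0 : null set0.
Proof.
by move=> eps eps0; exists 0; split=> //; [exact: component0|rewrite trunc_fun0].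
Qed.

(** Covers of values below [2^-(m + n)] have a supremum that is again a single component, and order
    continuity bounds its value by the sum, at most [2 * 2^-m < eps]. *)
Lemma null_bigcup (N : nat -> set X) : (forall n, null (N n)) ->
  null (\bigcup_n N n).
Proof.
move=> nN eps eps0; have /expr_half_lt[m hm] : 0 < eps / 2 by rewrite divr_gt0.
have /choice[q qP] n : exists q, [/\ component q, N n `<=` stone_set q &
    F q < 2^-1 ^+ (m + n)].
  by apply: nN; rewrite exprn_gt0// invr_gt0.
have [|s ss] := hE (S := range q).
  split; first by exists (q 0%N), 0%N.
  by exists e => _ [n _ <-]; apply: component_le; have [] := qP n.
have cq n : component (q n) by have [] := qP n.
have cs : component s.
  apply: (component_sup _ _ ss); first by exists (q 0%N), 0%N.
  by move=> _ [n _ <-].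
exists s; split=> // [w [n _ Nw]|].
  have [_ h _] := qP n; apply: (stone_set_le cs _ (h _ Nw)).
  by apply: ss.1; exists n.
apply: (@le_lt_trans _ _ (2 * 2^-1 ^+ m)); last by lra.
apply: (trunc_fun_sigma_subadditive phi_pos phi_oc _ ss
  (b := fun k => 2^-1 ^+ (m + k))) => n.
- exact: component_ge0.
- by have [_ _ /ltW] := qP n.
- exact: geometric_half_sum.
Qed.

Lemma nullU N N' : null N -> null N' -> null (N `|` N').
Proof.
move=> nN nN'; rewrite -bigcup2E; apply: null_bigcup => -[|[|n]]//=.
exact: null0.
Qed.

Lemma null_clopen p : component p -> null (stone_set p) -> p = 0.
Proof.
move=> cp np; apply: (trunc_fun_le0 phi_pos (he := he)).
apply/ler_addgt0Pl => eps /np[q [cq pq Fq]]; rewrite addr0.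
apply: le_trans (ltW Fq); apply: (trunc_fun_le he phi_pos (component_ge0 cp)).
exact: stone_set_sub.
Qed.

(** The Baire property with null sets in place of meagre sets. As [p] is determined by [A], the
    measure algebra becomes the algebra of components, in the manner of the Loomis-Sikorski
    theorem. *)
Definition almost_clopen A p := component p /\
  exists2 N, null N & forall w, ~ N w -> (A w <-> stone_set p w).

Lemma almost_clopen_sub A B p q : almost_clopen A p -> almost_clopen B q ->
  A `<=` B -> p <= q.
Proof.
move=> [cp [N nN AN]] [cq [M nM BM]] AB.
apply/(le_componentP cq (component_ge0 cp) (component_le cp)).
apply: null_clopen; first by apply: componentI => //; exact: componentB.
apply: null_sub (nullU nN nM) => w /(stone_setI _ cp (componentB cq))[wp].
rewrite stone_setC// => wq; apply: contrapT => /not_orP[wN wM]; apply: wq.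
by apply/BM => //; apply/AB/AN.
Qed.

Lemma almost_clopen_uniq A p q : almost_clopen A p -> almost_clopen A q -> p = q.
Proof.
move=> Ap Aq; apply/eqP; rewrite eq_le.
by rewrite (almost_clopen_sub Ap Aq)// (almost_clopen_sub Aq Ap).
Qed.

Lemma almost_clopen_clopen p : component p -> almost_clopen (stone_set p) p.
Proof. by move=> cp; split=> //; exists set0 => //; exact: null0. Qed.

Lemma almost_clopenC A p : almost_clopen A p -> almost_clopen (~` A) (e - p).
Proof.
move=> [cp [N nN AN]]; split; first exact: componentB.
by exists N => // w /AN wA; rewrite stone_setC// /setC/= wA.
Qed.

Lemma almost_clopen_null A : null A -> almost_clopen A 0.
Proof.
move=> nA; split; first exact: component0.
by exists A => // w wA; split=> // /stone_set0.
Qed.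

Lemma almost_clopenI A B p q : almost_clopen A p -> almost_clopen B q ->
  almost_clopen (A `&` B) (p `/\` q).
Proof.
move=> [cp [N nN AN]] [cq [M nM BM]]; split; first exact: componentI.
exists (N `|` M); first exact: nullU.
by move=> w /not_orP[/AN wA /BM wB]; rewrite stone_setI// /setI/= wA wB.
Qed.

(* The boundary [stone_set s `\` \bigcup_n stone_set (p n)] is included in the sets
   [stone_set (s - (p 0 `\/` ... `\/` p n))], whose measures tend to [0]. *)
Lemma almost_clopen_bigcup (A : nat -> set X) (p : nat -> E) s :
  (forall n, almost_clopen (A n) (p n)) -> supremums (range p) s ->
  almost_clopen (\bigcup_n A n) s.
Proof.
move=> Ap ss; have cp n : component (p n) := (Ap n).1.
have cs : component s.
  apply: (component_sup _ _ ss); first by exists (p 0%N), 0%N.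
  by move=> _ [n _ <-].
split=> //.
have /choice[N NP] n : exists N, null N /\
    forall w, ~ N w -> (A n w <-> stone_set (p n) w).
  by have [_ [N]] := Ap n; exists N.
pose M := stone_set s `\` \bigcup_n stone_set (p n).
exists (\bigcup_n N n `|` M); last first.
  move=> w /not_orP[wN wM]; split=> [[n _ wA]|ws].
    apply: (stone_set_le cs (p := p n)); first by apply: ss.1; exists n.
    by apply/(NP n).2 => // wNn; apply: wN; exists n.
  apply: contrapT => wA; apply: wM; split=> // -[n _ wp]; apply: wA; exists n => //.
  by apply/(NP n).2 => // wNn; apply: wN; exists n.
apply: nullU; first by apply: null_bigcup => n; exact: (NP n).1.
move=> eps eps0; pose j := partial_join p.
have sj := supremums_partial_join ss.
have cj n : component (j n).
  by elim: n => [|n IH]; [exact: cp|exact: (componentU IH (cp _))].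
have [n hn] := trunc_fun_sup_cvg he phi_pos phi_oc (partial_join_homo p) sj eps0.
have js : j n <= s by apply: sj.1; exists n.
(* The difference [s - j n], written as a meet so that it is visibly a component. *)
have cq : component (s `/\` (e - j n)) by apply: componentI => //; exact: componentB.
exists (s `/\` (e - j n)); split=> // [w [ws wp]|].
  apply/(stone_setI _ cs (componentB (cj n))); split=> //; apply/stone_setC => //.
  elim: n {hn js cq} => [|n IH] /= wj; first by apply: wp; exists 0%N.
  by move/(stone_setU _ (cj n) (cp n.+1)) : wj => [//|wj]; apply: wp; exists n.+1.
apply: le_lt_trans (hn n (leqnn n)); apply: (trunc_fun_le he phi_pos (component_ge0 cq)).
rewrite riesz_leBrD -disjoint_join; first by rewrite leUx leIl.
rewrite -meetA [(e - _) `/\` _]meetC (cj n); exact/meet_idPr/(component_ge0 cs).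
Qed.

Definition stone_measurable A := exists p, almost_clopen A p.

Lemma stone_measurable0 : stone_measurable set0.
Proof. by exists 0; apply: almost_clopen_null; exact: null0. Qed.

Lemma stone_measurableC A : stone_measurable A -> stone_measurable (~` A).
Proof. by move=> [p /almost_clopenC]; exists (e - p). Qed.

Lemma stone_measurable_bigcup (A : nat -> set X) :
  (forall n, stone_measurable (A n)) -> stone_measurable (\bigcup_n A n).
Proof.
move=> /choice[p pP]; have [|s ss] := hE (S := range p).
  split; first by exists (p 0%N), 0%N.
  by exists e => _ [n _ <-]; exact: component_le (pP n).1.
by exists s; exact: almost_clopen_bigcup ss.
Qed.

HB.instance Definition _ := isMeasurable.Build default_measure_display X
  stone_measurable0 stone_measurableC stone_measurable_bigcup.

Definition component_of A : E := xget 0 [set p | almost_clopen A p].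

Lemma component_of_eq A p : almost_clopen A p -> component_of A = p.
Proof. by move=> Ap; exact: almost_clopen_uniq (xgetI _ Ap) Ap. Qed.

Lemma component_ofP A : measurable A -> almost_clopen A (component_of A).
Proof. by move=> [p Ap]; exact: (xgetI _ Ap). Qed.

(** Dividing by the value of the unit makes the total mass 1. *)
Definition stone_measure A : \bar R := (F (component_of A) / F e)%:E.

Lemma trunc_fun_unit_gt0 : 0 < F e.
Proof.
rewrite lt_neqAle trunc_fun_ge0// andbT eq_sym; apply/eqP => /(trunc_fun_eq0 phi_pos) ee.
by have := he.1; rewrite ee ltxx.
Qed.

Lemma stone_measureE A p : almost_clopen A p -> stone_measure A = (F p / F e)%:E.
Proof. by move=> /component_of_eq; rewrite /stone_measure => ->. Qed.

Lemma stone_measure0 : stone_measure set0 = 0%E.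
Proof.
by rewrite (stone_measureE (almost_clopen_null null0)) trunc_fun0// mul0r.
Qed.

Lemma stone_measure_ge0 A : (0 <= stone_measure A)%E.
Proof. by rewrite lee_fin divr_ge0// trunc_fun_ge0. Qed.

(** Disjoint sets have disjoint components, because the component of the empty set is unique. The
    partial sums of these components are also their joins, so their values add up and, by order
    continuity, converge to the value of the supremum. *)
Lemma stone_measure_sigma_additive : semi_sigma_additive stone_measure.
Proof.
move=> A mA tA mUA; pose p n := component_of (A n).
have Ap n : almost_clopen (A n) (p n) by exact: component_ofP.
have cp n : component (p n) := (Ap n).1.
have dp m n : m != n -> p m `/\` p n = 0.
  move=> mn; apply: (@almost_clopen_uniq set0).
    move/trivIsetP : tA => /(_ m n I I mn) <-.
    exact: almost_clopenI.
  exact/almost_clopen_null/null0.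
have [|s ss] := hE (S := range p).
  split; first by exists (p 0%N), 0%N.
  by exists e => _ [n _ <-]; exact: component_le.
rewrite (stone_measureE (almost_clopen_bigcup Ap ss)).
pose z n := \sum_(0 <= k < n) p k.
have zP := component_disjoint_sum e0 cp dp.
have zS n : z n.+1 = z n `\/` p n.
  by rewrite /z big_nat_recr//= disjoint_join//; exact: (zP n).2.
have Fz n : F (z n) = \sum_(0 <= k < n) F (p k).
  elim: n => [|n IH]; first by rewrite /z !big_nil trunc_fun0.
  rewrite /z !big_nat_recr//= trunc_fun_disjointD ?IH//.
  - exact: component_ge0 (zP n).1.
  - exact: component_ge0.
  - exact: (zP n).2.
have zs n : z n <= s.
  elim: n => [|n IH]; last by rewrite zS leUx IH; apply: ss.1; exists n.
  by rewrite /z big_nil (le_trans (component_ge0 (cp 0%N)))//; apply: ss.1; exists 0%N.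
have supz : supremums (range z) s.
  split=> [_ [n _ <-]//|u uz]; apply: ss.2 => _ [n _ <-].
  by apply: (@le_trans _ _ (z n.+1)); [rewrite zS leUr|apply: uz; exists n.+1].
have zi m n : (m <= n)%N -> z m <= z n.
  elim: n => [|n IH]; first by rewrite leqn0 => /eqP ->.
  by rewrite leq_eqVlt => /predU1P[->//|/IH h]; rewrite zS (le_trans h)// leUl.
rewrite (_ : (fun n => _) = (fun n => (F (z n) / F e)%:E)); last first.
  by apply/funext => n; rewrite Fz mulr_suml -sumEFin.
apply: cvg_EFin; first by near=> n.
apply: cvgM; last exact: cvg_cst.
apply/cvgrPdist_lt => eps eps0.
have [N NF] := trunc_fun_sup_cvg he phi_pos phi_oc zi supz eps0.
exists N => // n /= /NF; apply: le_lt_trans.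
have Fsz : F s <= F (s - z n) + F (z n).
  by rewrite -{1}[s](subrK (z n)); exact: trunc_funD_le.
have Fzs : F (z n) <= F s.
  by apply: (trunc_fun_le he phi_pos) => //; exact: component_ge0 (zP n).1.
by rewrite ger0_norm ?subr_ge0// lerBlDr.
Unshelve. all: by end_near. Qed.

HB.instance Definition _ := isMeasure.Build _ X R stone_measure
  stone_measure0 stone_measure_ge0 stone_measure_sigma_additive.

Lemma stone_measure_setT : stone_measure setT = 1%E.
Proof.
have -> : setT = stone_set e by apply/seteqP; split=> // w _; exact: stone_set1.
rewrite (stone_measureE (almost_clopen_clopen (component1 e0))) divff//.
by rewrite gt_eqF// trunc_fun_unit_gt0.
Qed.

HB.instance Definition _ := Measure_isProbability.Build _ X R stone_measure
  stone_measure_setT.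

(** Together with the converse below, this lets statements holding almost everywhere be proved and
    used through clopen covers of small value. *)
Lemma stone_negligible N : null N -> stone_measure.-negligible N.
Proof.
move=> nN; exists N; split=> //; first by exists 0; exact: almost_clopen_null.
by rewrite (stone_measureE (almost_clopen_null nN)) trunc_fun0// mul0r.
Qed.

Lemma null_negligible N : stone_measure.-negligible N -> null N.
Proof.
move=> [A [mA A0 NA]]; apply: null_sub NA _.
have := component_ofP mA; set p := component_of A => Ap.
have p0 : p = 0.
  apply: (trunc_fun_eq0 phi_pos (he := he)).
  move: A0; rewrite (stone_measureE Ap) => -[] /eqP.
  rewrite mulf_eq0 invr_eq0 (gt_eqF trunc_fun_unit_gt0) orbF => /eqP.
  exact.
move: Ap; rewrite p0 => -[_ [M nM AM]]; apply: null_sub nM => w Aw.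
by apply: contrapT => /AM /iffLR /(_ Aw); exact: stone_set0.
Qed.

End stone_space.
(** * Representation on the Stone space *)

Section lattice_isomorphism_theory.
Context {R : realType} {E G : rieszSpaceType R} {T : {linear E -> G}}.
Hypothesis hT : lattice_isomorphism T.

Lemma lattice_iso_le x y : (T x <= T y) = (x <= y).
Proof.
apply/idP/idP => /meet_idPl h; apply/meet_idPl.
  by apply: (lattice_iso_inj hT); rewrite (lattice_iso_meet hT).
by rewrite -(lattice_iso_meet hT) h.
Qed.

Lemma lattice_iso_rabs x : T (rabs x) = rabs (T x).
Proof. by rewrite /rabs (lattice_iso_join hT) raddfN. Qed.

End lattice_isomorphism_theory.

Lemma lattice_isomorphism_of_join (R : realType) (E G : rieszSpaceType R)
    (T : {linear E -> G}) : injective T -> {morph T : x y / x `\/` y} ->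
  lattice_isomorphism T.
Proof.
move=> Ti TU; split=> // x y.
have -> : x `/\` y = - (- x `\/` - y) by rewrite riesz_oppU !opprK.
by rewrite linearN TU !linearN riesz_oppU !opprK.
Qed.

Section L0_theory.
Context d (X : measurableType d) (R : realType) (mu : {measure set X -> \bar R}).
Implicit Types (f g : L0 mu) (a : R).

Lemma L0_leE f g : (f <= g) <-> \forall x \ae mu, L0_repr f x <= L0_repr g x.
Proof. by split=> [/L0_leP|/L0_leP]. Qed.

Lemma L0_aeD f g : \forall x \ae mu, L0_repr (f + g) x = L0_repr f x + L0_repr g x.
Proof. exact: L0_addE. Qed.

Lemma L0_aeN f : \forall x \ae mu, L0_repr (- f) x = - L0_repr f x.
Proof. exact: L0_oppE. Qed.

Lemma L0_aeZ a f : \forall x \ae mu, L0_repr (a *: f) x = a * L0_repr f x.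
Proof. exact: L0_scaleE. Qed.

Lemma L0_ae0 : \forall x \ae mu, L0_repr (0 : L0 mu) x = 0.
Proof. exact: L0_zeroE. Qed.

Lemma L0_aeI f g :
  \forall x \ae mu, L0_repr (f `/\` g) x = Num.min (L0_repr f x) (L0_repr g x).
Proof. exact: L0_meetE. Qed.

Lemma L0_aeU f g :
  \forall x \ae mu, L0_repr (f `\/` g) x = Num.max (L0_repr f x) (L0_repr g x).
Proof. exact: L0_joinE. Qed.

Lemma L0_ae1 : \forall x \ae mu, L0_repr (L0_class mu 1) x = 1.
Proof. exact: L0_classE. Qed.

Lemma L0_aeB f g : \forall x \ae mu, L0_repr (f - g) x = L0_repr f x - L0_repr g x.
Proof. by apply: filterS2 (L0_aeD f (- g)) (L0_aeN g) => x -> ->. Qed.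

Definition mk_mfun (f : X -> R) (mf : measurable_fun setT f) : {mfun X >-> R} :=
  mfun_Sub (mem_set mf).

Lemma L0_fun_class (f : X -> R) (mf : measurable_fun setT f) :
  \forall x \ae mu, L0_repr (L0_class mu (mk_mfun mf)) x = f x.
Proof. exact: L0_classE. Qed.

End L0_theory.

(** * The function on the Stone space attached to an element *)

Section stone_representation.
Context {R : realType} {E : rieszSpaceType R} {e : E}.
Variables (hE : dedekind_complete E) (he : weak_order_unit e).
Variables (phi : {scalar ideal_type (principal_ideal e)}).
Variables (phi_pos : strictly_positive phi) (phi_oc : order_continuous phi).
Implicit Types (x y p q : E) (t s : R).
Let e0 : 0 <= e := weak_unit_ge0 he.
Local Notation component := (@component R E e).
Local Notation F := (trunc_fun he phi).
Local Notation X := (stone hE he phi_pos phi_oc).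
Local Notation mu := (@stone_measure R E e hE he phi phi_pos phi_oc : probability _ R).
Local Notation car := (carrier e).
Implicit Types (w : X) (A N : set X).

Lemma null_ae (P : X -> Prop) : null (~` [set w | P w]) -> \forall w \ae mu, P w.
Proof. exact: stone_negligible. Qed.

Lemma ae_null (P : X -> Prop) : (\forall w \ae mu, P w) -> null (~` [set w | P w]).
Proof. exact: null_negligible. Qed.

(* The component [car (x - t e)] plays the role of the event [x > t]. *)
Definition levels x w : set R := [set t | stone_set (car (x - t *: e)) w].

(* On a null set of points, [levels x w] is empty or unbounded above, and [sup] has
   the junk value [0]. *)
Definition stone_fun x w : R := sup (levels x w).

(** Since [levels x w] is closed downwards, a missing point is an upper bound: the two conditions
    say that the supremum is a genuine real number. *)
Definition finite_at x w := (exists t, levels x w t) /\ (exists t, ~ levels x w t).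

Let car_comp u : component (car u). Proof. exact: carrier_component. Qed.

Lemma levels_down x w s t : s <= t -> levels x w t -> levels x w s.
Proof.
move=> st; apply: stone_set_le => //; apply: ler_carrier => //; apply: ler_rpos.
by rewrite riesz_lerD2l riesz_leN2 riesz_leZl.
Qed.

Lemma levels_has_sup x w : finite_at x w -> has_sup (levels x w).
Proof.
move=> [[t wt] [s ws]]; split; first by exists t.
exists s => r wr; rewrite leNgt; apply/negP => /ltW sr; apply: ws.
exact: levels_down sr wr.
Qed.

Lemma levels_le x w t : finite_at x w -> levels x w t -> t <= stone_fun x w.
Proof. by move=> /levels_has_sup h wt; exact: sup_upper_bound. Qed.

Lemma lt_levels x w t : finite_at x w -> t < stone_fun x w -> levels x w t.
Proof.
move=> fx tf; have h : 0 < stone_fun x w - t by rewrite subr_gt0.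
have [s ws] := sup_adherent h (levels_has_sup fx).
by rewrite subKr => /ltW ts; exact: levels_down ts ws.
Qed.

Lemma levelsD x y w s t : levels x w s -> levels y w t -> levels (x + y) w (s + t).
Proof.
move=> wx wy; have : stone_set (car (x - s *: e) `/\` car (y - t *: e)) w.
  exact/stone_setI.
apply: stone_set_le => //; apply: le_trans (carrierD hE he _ _) _.
by rewrite scalerDl opprD addrACA.
Qed.

(** Read as [x > s] or [x < t]. The gap [t - s] provides the positive multiple of [e] below the sum
    of the two elements; with [s = t] both events could fail where [x = s]. *)
Lemma levelsN x w s t : s < t -> levels x w s \/ levels (- x) w (- t).
Proof.
move=> st; have : stone_set (car (x - s *: e) `\/` car (- x - (- t) *: e)) w.
  rewrite (@carrier_join_unit _ _ _ hE he _ _ (t - s)) ?subr_gt0//.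
    exact: stone_set1.
  by rewrite addrACA subrr add0r scaleNr opprK scalerBl addrC.
by move/stone_setU; apply.
Qed.

Lemma levels0 w t : levels 0 w t <-> t < 0.
Proof.
rewrite /levels/= sub0r -scaleNr; split=> [wt|t0].
  rewrite ltNge; apply/negP => t0; move: wt; rewrite carrier_eq0//.
    exact: stone_set0.
  by rewrite scaleNr -oppr0 riesz_leN2 riesz_scale_ge0.
by rewrite carrierZ ?oppr_gt0// carrier_unit//; exact: stone_set1.
Qed.

Lemma levelsU x y w t : levels (x `\/` y) w t <-> levels x w t \/ levels y w t.
Proof. by rewrite /levels/= riesz_joinDr carrierU// stone_setU. Qed.

Lemma levelsZ a x w t : 0 < a -> levels (a *: x) w (a * t) <-> levels x w t.
Proof. by move=> a0; rewrite /levels/= -scalerA -scalerBr carrierZ. Qed.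

(** The carriers of [y - (n + 1) e] decrease to 0, so by order continuity their clopen sets are
    covers of arbitrarily small value of the points where [y] is infinite. Taking [y = x] and
    [y = - x] excludes both infinities. *)
Lemma finite_at_ae x : \forall w \ae mu, finite_at x w.
Proof.
have key y : null [set w | forall n : nat, levels y w n.+1%:R].
  move=> eps eps0; pose p n := car (y - n.+1%:R *: e).
  have pd m n : (m <= n)%N -> p n <= p m.
    move=> mn; apply: ler_carrier => //; apply: ler_rpos.
    by rewrite riesz_lerD2l riesz_leN2 riesz_leZl// ler_nat.
  have pinf : infimums (range p) 0.
    split=> [_ [n _ <-]|l lp]; first exact: carrier_ge0.
    apply: rpos_eq0; apply: (carrier_inf0 hE he (x := y)) (rpos_ge0 _) _ => n.
    by apply: rpos_le; [apply: lp; exists n|exact: carrier_ge0].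
  have [N NF] := trunc_fun_cvg0_seq he phi_pos phi_oc pd pinf eps0.
  by exists (p N); split; [exact: car_comp|move=> w; exact|exact: NF].
apply: null_ae; apply: null_sub (nullU (key x) (key (- x))) => w /= /not_andP[wx|wx].
  (* One unit is subtracted to create the gap that [levelsN] asks for. *)
  right => n; have st : - n.+1%:R - 1 < - n.+1%:R :> R by lra.
  have [wxn|] := levelsN x w st; last by rewrite opprK.
  by exfalso; apply: wx; exists (- n.+1%:R - 1).
by left => n; apply: contrapT => h; apply: wx; exists n.+1%:R.
Qed.

Lemma stone_fun_superadd x y w : finite_at x w -> finite_at y w ->
  finite_at (x + y) w -> stone_fun x w + stone_fun y w <= stone_fun (x + y) w.
Proof.
move=> fx fy fxy; apply/ler_addgt0Pl => eps eps0; rewrite -lerBlDl.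
rewrite (_ : _ - eps = (stone_fun x w - eps / 2) + (stone_fun y w - eps / 2)); last lra.
by apply: levels_le => //; apply: levelsD; apply: lt_levels => //; lra.
Qed.

Lemma stone_funN x w : finite_at x w -> finite_at (- x) w ->
  stone_fun (- x) w = - stone_fun x w.
Proof.
move=> fx fNx.
have f0 : finite_at 0 w.
  by split; [exists (-1); apply/levels0; lra|exists 1 => /levels0; lra].
apply/eqP; rewrite eq_le; apply/andP; split.
  have h : stone_fun 0 w <= 0.
    apply: ge_sup; first by exists (-1); apply/levels0; lra.
    by move=> t /levels0 /ltW.
  have := @stone_fun_superadd x (- x) w fx fNx; rewrite subrr => /(_ f0).
  by move: h; lra.
apply/ler_addgt0Pl => eps eps0.
have st : stone_fun x w + eps / 2 < stone_fun x w + eps by lra.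
have [wx|wNx] := levelsN x w st.
- by have := levels_le fx wx; lra.
- by have := levels_le fNx wNx; lra.
Qed.

(** At finite points the event [stone_fun x > r] is the countable union of the clopen sets of the
    levels [r + 1 / (n + 1)]. The other points form a null set, all of whose subsets are
    measurable. *)
Lemma measurable_stone_fun x : measurable_fun setT (stone_fun x).
Proof.
move=> _; apply: (measurability _ (RGenOInfty.measurableE R)) => //.
move=> _ /= [_ [r ->] <-]; rewrite setTI preimage_itvoy.
pose G := [set w | finite_at x w].
have mN N : null N -> measurable N.
  by move=> nN; exists 0; exact: almost_clopen_null.
have nG : null (~` G) by exact/ae_null/finite_at_ae.
have mG : measurable G by rewrite -(setCK G); exact/measurableC/mN.
rewrite [X in measurable X](_ : _ =
  (G `&` \bigcup_n stone_set (car (x - (r + n.+1%:R^-1) *: e))) `|`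
  ([set w | r < stone_fun x w] `&` ~` G)).
  apply: measurableU.
    apply: measurableI => //; apply: bigcupT_measurable => n.
    by exists (car (x - (r + n.+1%:R^-1) *: e)); exact: almost_clopen_clopen.
  by apply: mN; apply: null_sub nG => w [].
apply/seteqP; split=> w /=.
  move=> rx; have [Gw|Gw] := pselect (G w); last by right.
  left; split=> //; have [n rn] := ltr_add_invr rx.
  by exists n => //; exact: lt_levels.
move=> [[Gw [n _ wn]]|[]//]; apply: lt_le_trans (levels_le Gw wn).
by rewrite ltrDl invr_gt0 ltr0n.
Qed.

Definition stone_rep x : L0 mu := L0_class mu (mk_mfun (measurable_stone_fun x)).

Lemma stone_repE x : \forall w \ae mu, L0_repr (stone_rep x) w = stone_fun x w.
Proof. exact: L0_fun_class. Qed.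

(** Superadditivity is the direct half. The other half is superadditivity for [x + y] and [- y],
    combined with oddness. *)
Lemma stone_funD_ae x y :
  \forall w \ae mu, stone_fun (x + y) w = stone_fun x w + stone_fun y w.
Proof.
near=> w.
have fx : finite_at x w by near: w; exact: finite_at_ae.
have fy : finite_at y w by near: w; exact: finite_at_ae.
have fNy : finite_at (- y) w by near: w; exact: finite_at_ae.
have fxy : finite_at (x + y) w by near: w; exact: finite_at_ae.
apply/eqP; rewrite eq_le stone_fun_superadd// andbT.
have := @stone_fun_superadd (x + y) (- y) w fxy fNy.
by rewrite addrK stone_funN// => /(_ fx); lra.
Unshelve. all: by end_near. Qed.

Lemma stone_funZ_ae a x : \forall w \ae mu, stone_fun (a *: x) w = a * stone_fun x w.
Proof.
have pos b : 0 < b -> \forall w \ae mu, stone_fun (b *: x) w = b * stone_fun x w.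
  move=> b0; near=> w.
  have fx : finite_at x w by near: w; exact: finite_at_ae.
  have fbx : finite_at (b *: x) w by near: w; exact: finite_at_ae.
  apply/eqP; rewrite eq_le; apply/andP; split.
    rewrite -ler_pdivrMl//; apply/ler_addgt0Pl => eps eps0; rewrite -lerBlDl.
    apply: levels_le => //; apply/(levelsZ _ _ _ b0); apply: lt_levels => //.
    by rewrite mulrBr mulrA mulfV ?gt_eqF// mul1r ltrBlDr ltrDl mulr_gt0.
  rewrite -ler_pdivlMl//; apply/ler_addgt0Pl => eps eps0; rewrite -lerBlDl.
  rewrite ler_pdivlMl//; apply: levels_le => //; apply/(levelsZ _ _ _ b0).
  by apply: lt_levels => //; lra.
have [a0|a0|<-] := ltgtP 0 a; first exact: pos.
  have Na0 : 0 < - a by rewrite oppr_gt0.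
  near=> w.
  have -> : stone_fun (a *: x) w = - stone_fun ((- a) *: x) w.
    rewrite -[in LHS](opprK a) scaleNr; apply: stone_funN.
      by near: w; exact: finite_at_ae.
    by near: w; exact: finite_at_ae.
  have -> : stone_fun ((- a) *: x) w = (- a) * stone_fun x w by near: w; exact: pos.
  by rewrite mulNr opprK.
near=> w; rewrite mul0r scale0r.
have : stone_fun (0 + 0) w = stone_fun 0 w + stone_fun 0 w.
  by near: w; exact: stone_funD_ae.
by rewrite addr0 => /eqP; rewrite -subr_eq0 opprD addrA subrr sub0r oppr_eq0 => /eqP.
Unshelve. all: by end_near. Qed.

Lemma stone_rep_linear : linear stone_rep.
Proof.
move=> a x y; apply: L0P; near=> w.
have -> : L0_repr (stone_rep (a *: x + y)) w = stone_fun (a *: x + y) w.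
  by near: w; exact: stone_repE.
have -> : L0_repr (a *: stone_rep x + stone_rep y) w =
    L0_repr (a *: stone_rep x) w + L0_repr (stone_rep y) w.
  by near: w; exact: L0_aeD.
have -> : L0_repr (a *: stone_rep x) w = a * L0_repr (stone_rep x) w.
  by near: w; exact: L0_aeZ.
have -> : L0_repr (stone_rep x) w = stone_fun x w by near: w; exact: stone_repE.
have -> : L0_repr (stone_rep y) w = stone_fun y w by near: w; exact: stone_repE.
have -> : stone_fun (a *: x + y) w = stone_fun (a *: x) w + stone_fun y w.
  by near: w; exact: stone_funD_ae.
by congr (_ + _); near: w; exact: stone_funZ_ae.
Unshelve. all: by end_near. Qed.

HB.instance Definition _ := GRing.isLinear.Build R E (L0 mu) _ stone_rep stone_rep_linear.

Lemma stone_repU : {morph stone_rep : x y / x `\/` y}.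
Proof.
move=> x y; apply: L0P; near=> w.
have -> : L0_repr (stone_rep (x `\/` y)) w = stone_fun (x `\/` y) w.
  by near: w; exact: stone_repE.
have -> : L0_repr (stone_rep x `\/` stone_rep y) w =
    Num.max (L0_repr (stone_rep x) w) (L0_repr (stone_rep y) w).
  by near: w; exact: L0_aeU.
have -> : L0_repr (stone_rep x) w = stone_fun x w by near: w; exact: stone_repE.
have -> : L0_repr (stone_rep y) w = stone_fun y w by near: w; exact: stone_repE.
have fx : finite_at x w by near: w; exact: finite_at_ae.
have fy : finite_at y w by near: w; exact: finite_at_ae.
have fxy : finite_at (x `\/` y) w by near: w; exact: finite_at_ae.
apply/eqP; rewrite eq_le ge_max; apply/andP; split.
  apply/ler_addgt0Pl => eps eps0; rewrite -lerBlDl.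
  have /levelsU[wx|wy] : levels (x `\/` y) w (stone_fun (x `\/` y) w - eps).
  - by apply: lt_levels => //; lra.
  - by rewrite le_max levels_le.
  - by rewrite le_max (levels_le fy)// orbT.
by apply/andP; split; apply/ler_addgt0Pl => eps eps0; rewrite -lerBlDl;
  apply: levels_le => //; apply/levelsU; [left|right]; apply: lt_levels => //; lra.
Unshelve. all: by end_near. Qed.

(** If [z] is not 0, some [|z| - e / (n + 1)] has a non-zero carrier. Its clopen set is not null,
    and there the function of [|z|] is at least [1 / (n + 1)]. *)
Lemma stone_rep_inj : injective stone_rep.
Proof.
move=> x y xy; apply/eqP; rewrite -subr_eq0; apply/eqP.
have : stone_rep (x - y) = 0 by rewrite raddfB /= xy subrr.
move: (x - y) => {xy}z z0; apply: rabs0_eq0; apply/eqP.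
rewrite eq_le rabs_ge0 andbT; apply: contrapT => /(carrier_pos_neq0 hE he)[n].
set p := car _; apply; apply: (@null_clopen _ _ _ hE he _ phi_pos phi_oc _ (car_comp _)).
have rz0 : stone_rep (rabs z) = 0.
  by rewrite /rabs stone_repU raddfN /= z0 oppr0 joinxx.
have : \forall w \ae mu, ~ stone_set p w.
  near=> w; move=> wp.
  have fz : finite_at (rabs z) w by near: w; exact: finite_at_ae.
  have : L0_repr (stone_rep (rabs z)) w = stone_fun (rabs z) w.
    by near: w; exact: stone_repE.
  have -> : L0_repr (stone_rep (rabs z)) w = 0.
    by rewrite rz0; near: w; exact: L0_ae0.
  have := levels_le fz wp.
  have n0 : 0 < n.+1%:R^-1 :> R by rewrite invr_gt0 ltr0n.
  by move=> /(lt_le_trans n0) h0 h1; move: h0; rewrite -h1 ltxx.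
by move/ae_null; apply: null_sub => w wp; rewrite /= notK.
Unshelve. all: by end_near. Qed.

Lemma stone_rep_isomorphism : lattice_isomorphism stone_rep.
Proof. exact: lattice_isomorphism_of_join stone_rep_inj stone_repU. Qed.

(** The functions of [p] and [e - p] take values in [[0, 1]], are positive only on their own clopen
    sets, and add up to the function of [e], which is 1. *)
Lemma stone_fun_component p : component p -> \forall w \ae mu,
  (stone_set p w -> stone_fun p w = 1) /\ (~ stone_set p w -> stone_fun p w = 0).
Proof.
have up q w : component q -> finite_at q w -> 0 < stone_fun q w -> stone_set q w.
  move=> cq fq q0; have : levels q w 0 by exact: lt_levels.
  by rewrite /levels/= scale0r subr0 carrier_component_id.
have le1 q w : component q -> finite_at q w -> stone_fun q w <= 1.
  move=> cq fq; apply: ge_sup; first exact: (levels_has_sup fq).1.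
  move=> t wt; rewrite leNgt; apply/negP => t1; move: wt; rewrite /levels/=.
  rewrite carrier_eq0//; first exact: stone_set0.
  rewrite riesz_leBlD add0r (le_trans (component_le cq))//.
  by rewrite -[leLHS]scale1r riesz_leZl// ltW.
have ge0 q w : component q -> finite_at q w -> 0 <= stone_fun q w.
  move=> cq fq; apply/ler_addgt0Pl => eps eps0; rewrite -lerBlDl sub0r.
  apply: levels_le => //; rewrite /levels/=.
  apply: (@stone_set_le _ _ _ _ _ _ _ _ e); first exact: car_comp.
    rewrite -[leLHS](carrier_unit hE he) -(carrierZ hE he _ eps0).
    apply: ler_carrier => //; apply: ler_rpos.
    by rewrite scaleNr opprK riesz_lerDr// (component_ge0 cq).
  exact: stone_set1.
have f1 : \forall w \ae mu, stone_fun e w = 1.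
  near=> w; have fe : finite_at e w by near: w; exact: finite_at_ae.
  apply/eqP; rewrite eq_le (le1 _ _ (component1 e0) fe)/=.
  apply/ler_addgt0Pl => eps eps0; rewrite -lerBlDl; apply: levels_le => //.
  have ee : e - (1 - eps) *: e = eps *: e.
    by rewrite -{1}[e]scale1r -scalerBl subKr.
  by rewrite /levels/= ee carrierZ// carrier_unit//; exact: stone_set1.
move=> cp; near=> w.
have fp : finite_at p w by near: w; exact: finite_at_ae.
have fq : finite_at (e - p) w by near: w; exact: finite_at_ae.
have : stone_fun (e - p + p) w = stone_fun (e - p) w + stone_fun p w.
  by near: w; exact: stone_funD_ae.
rewrite subrK; have -> : stone_fun e w = 1 by near: w; exact: f1.
have := ge0 _ _ cp fp; have := le1 _ _ cp fp.
have cq := componentB cp.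
have := ge0 _ _ cq fq; have := le1 _ _ cq fq.
move=> q1 q0 p1 p0 pq; split=> [wp|wp].
  suff : ~ (0 < stone_fun (e - p) w) by move/negP; rewrite -leNgt; lra.
  by move/(up _ _ cq fq)/stone_setC; apply.
suff : ~ (0 < stone_fun p w) by move/negP; rewrite -leNgt; lra.
by move/(up _ _ cp fp).
Unshelve. all: by end_near. Qed.

Lemma stone_rep1 : stone_rep e = L0_class mu 1.
Proof.
apply: L0P; near=> w.
have -> : L0_repr (stone_rep e) w = stone_fun e w by near: w; exact: stone_repE.
have -> : L0_repr (L0_class mu 1) w = 1 by near: w; exact: L0_ae1.
suff [h _] : (stone_set e w -> stone_fun e w = 1) /\
    (~ stone_set e w -> stone_fun e w = 0).
  exact/h/stone_set1.
by near: w; apply: stone_fun_component; exact: component1.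
Unshelve. all: by end_near. Qed.

(** * Surjectivity of the representation from lateral completeness *)

Section surjectivity.
Hypothesis hL : laterally_complete E.

Lemma stone_rep_step (A : nat -> set X) (a : nat -> R) :
  (forall n, measurable (A n)) -> trivIset setT A -> (forall n, 0 <= a n) ->
  exists x, \forall w \ae mu, forall n, A n w -> L0_repr (stone_rep x) w = a n.
Proof.
move=> mA tA a0; pose p n := component_of (A n).
have Ap n : almost_clopen (A n) (p n) by exact: component_ofP.
have cp n : component (p n) := (Ap n).1.
have p0 n := component_ge0 (cp n).
have dp m n : m != n -> p m `/\` p n = 0.
  move=> mn; apply: (@almost_clopen_uniq _ _ _ hE he _ phi_pos phi_oc set0).
    move/trivIsetP : tA => /(_ m n I I mn) <-.
    exact: almost_clopenI.
  exact/almost_clopen_null/null0.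
have dZ b c m n : 0 <= b -> 0 <= c -> m != n -> (b *: p m) `/\` (c *: p n) = 0.
  rewrite le_eqVlt => /predU1P[<-|b0].
    by rewrite scale0r => c0 _; apply/meet_idPl; rewrite riesz_scale_ge0.
  rewrite le_eqVlt => /predU1P[<-|c0 mn].
    by rewrite scale0r => _; apply/meet_idPr; rewrite riesz_scale_ge0// ltW.
  apply: (@disjointZ _ _ b^-1); rewrite ?invr_gt0 ?riesz_scale_ge0 ?(ltW b0) ?(ltW c0)//.
  rewrite scalerA mulVf ?gt_eqF// scale1r meetC.
  apply: (@disjointZ _ _ c^-1); rewrite ?invr_gt0 ?riesz_scale_ge0 ?(ltW b0) ?(ltW c0)//.
  by rewrite scalerA mulVf ?gt_eqF// scale1r dp// eq_sym.
pose S := range (fun n => a n *: p n).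
have [|||s ss] := hL (S := S).
- by exists (a 0%N *: p 0%N), 0%N.
- by move=> _ [n _ <-]; rewrite riesz_scale_ge0.
- move=> _ _ [m _ <-] [n _ <-] mn; rewrite /disjoint_elts !ger0_rabs ?riesz_scale_ge0//.
  by apply: dZ => //; apply/eqP => mn'; apply: mn; rewrite mn'.
(* The meet isolates the n-th term, the others being disjoint from [p n]. The cap [a n + 1] exceeds
   [a n], so on [A n] a minimum equal to [a n] must come from the function of [s]. *)
have sn n : s `/\` ((a n + 1) *: p n) = a n *: p n.
  have [h1 h2] := supremums_meet ((a n + 1) *: p n) ss.
  have an1 : 0 <= a n + 1 by rewrite addr_ge0.
  have an : a n *: p n <= (a n + 1) *: p n by rewrite riesz_leZl// lerDl.
  apply/eqP; rewrite eq_le; apply/andP; split; last first.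
    by rewrite lexI an andbT; apply: ss.1; exists n.
  apply: h2 => _ [_ [m _ <-] <-]; have [->|mn] := eqVneq m n; first exact: leIl.
  by rewrite dZ// riesz_scale_ge0.
exists s; apply: ae_foralln => n; near=> w => wA.
have wp : stone_set (p n) w.
  suff : A n w <-> stone_set (p n) w by move=> <-.
  near: w; have [_ [N nN NP]] := Ap n; apply: null_ae.
  by apply: null_sub nN => w /= wN; apply: contrapT => /NP.
have pw : L0_repr (stone_rep (p n)) w = 1.
  have -> : L0_repr (stone_rep (p n)) w = stone_fun (p n) w by near: w; exact: stone_repE.
  suff [h _] : (stone_set (p n) w -> stone_fun (p n) w = 1) /\
      (~ stone_set (p n) w -> stone_fun (p n) w = 0) by exact: h.
  by near: w; exact: stone_fun_component.
have := congr1 (fun x => L0_repr (stone_rep x) w) (sn n).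
rewrite (lattice_iso_meet stone_rep_isomorphism) !linearZ /=.
have -> : L0_repr (a n *: stone_rep (p n)) w = a n * L0_repr (stone_rep (p n)) w.
  by near: w; exact: L0_aeZ.
have -> : L0_repr (stone_rep s `/\` (a n + 1) *: stone_rep (p n)) w =
    Num.min (L0_repr (stone_rep s) w) (L0_repr ((a n + 1) *: stone_rep (p n)) w).
  by near: w; exact: L0_aeI.
have -> : L0_repr ((a n + 1) *: stone_rep (p n)) w =
    (a n + 1) * L0_repr (stone_rep (p n)) w.
  by near: w; exact: L0_aeZ.
rewrite pw !mulr1 /Num.min; case: ifP => // _ h.
by exfalso; move: h; lra.
Unshelve. all: by end_near. Qed.

(* [f] is at distance at most [1 / (k + 1)] of the step function
   [truncn ((k + 1) f) / (k + 1)]. *)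
Lemma stone_rep_onto_ge0 (f : L0 mu) : 0 <= f -> exists x, stone_rep x = f.
Proof.
move=> f0; pose v (k : nat) (w : X) : R := k.+1%:R * L0_repr f w.
pose A k n : set X := [set w | Num.truncn (v k w) = n].
have mB k n : measurable [set w | v k w < n%:R].
  rewrite (_ : [set w | _] = L0_repr f @^-1` `]-oo, (k.+1%:R^-1 * n%:R)[).
    by apply: measurable_funPTI; exact: measurable_itv.
  by apply/seteqP; split=> w /=; rewrite in_itv /= ltr_pdivlMl ?ltr0n.
have mA k n : measurable (A k n).
  case: n => [|n].
    rewrite (_ : A k 0%N = [set w | v k w < 1%:R])//.
    by apply/seteqP; split=> w; rewrite /A/= -truncn_le_nat leqn0 => /eqP.
  rewrite (_ : A k n.+1 = [set w | v k w < n.+2%:R] `\` [set w | v k w < n.+1%:R]).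
    exact: measurableD.
  apply/seteqP; split=> w; rewrite /A/setD/= -!truncn_le_nat.
    by move=> ->; rewrite leqnn ltnn.
  by move=> [h /negP]; rewrite -ltnNge => h'; apply/eqP; rewrite eqn_leq h.
have tA k : trivIset setT (A k).
  apply/trivIsetP => m n _ _ /eqP mn; rewrite -subset0 => w [/= wm wn].
  by apply: mn; rewrite -wm -wn.
have /choice[x xP] k := stone_rep_step (mA k) (tA k)
  (fun n => divr_ge0 (ler0n R n) (ler0n R k.+1)).
have xf k : \forall w \ae mu, L0_repr (stone_rep (x k)) w <= L0_repr f w <=
    L0_repr (stone_rep (x k)) w + k.+1%:R^-1.
  near=> w.
  have -> : L0_repr (stone_rep (x k)) w = (Num.truncn (v k w))%:R / k.+1%:R.
    have h : forall n, A k n w -> L0_repr (stone_rep (x k)) w = n%:R / k.+1%:R.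
      by near: w; exact: xP.
    exact: h.
  have fw : 0 <= L0_repr f w.
    have <- : L0_repr (0 : L0 mu) w = 0 by near: w; exact: L0_ae0.
    by near: w; exact/L0_leE.
  have k0 : 0 < k.+1%:R :> R by rewrite ltr0n.
  have /truncn_itv/andP[h1 h2] : 0 <= v k w by rewrite mulr_ge0.
  rewrite ler_pdivrMr// mulrC h1/= -{2}[k.+1%:R^-1]mul1r -mulrDl natr1.
  by rewrite ler_pdivlMr// mulrC ltW.
have iso := stone_rep_isomorphism.
(* The isomorphism reflects the order, so both functions being close to [f] yields an inequality in
   [E]. It bounds the sequence [x], whose supremum then stays within [1 / (k + 1)] of each [x k]. *)
have xle j k : x j <= x k + k.+1%:R^-1 *: e.
  rewrite -(lattice_iso_le iso) !linearD linearZ /= stone_rep1; apply/L0_leE; near=> w.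
  have -> : L0_repr (stone_rep (x k) + k.+1%:R^-1 *: L0_class mu 1) w =
      L0_repr (stone_rep (x k)) w + L0_repr (k.+1%:R^-1 *: L0_class mu 1) w.
    by near: w; exact: L0_aeD.
  have -> : L0_repr (k.+1%:R^-1 *: L0_class mu 1) w =
      k.+1%:R^-1 * L0_repr (L0_class mu 1) w by near: w; exact: L0_aeZ.
  have -> : L0_repr (L0_class mu 1) w = 1 by near: w; exact: L0_ae1.
  rewrite mulr1.
  have /andP[h _] : L0_repr (stone_rep (x j)) w <= L0_repr f w <=
    L0_repr (stone_rep (x j)) w + j.+1%:R^-1 by near: w; exact: xf.
  have /andP[_ h'] : L0_repr (stone_rep (x k)) w <= L0_repr f w <=
    L0_repr (stone_rep (x k)) w + k.+1%:R^-1 by near: w; exact: xf.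
  exact: le_trans h h'.
have [|s ss] := hE (S := range x).
  split; first by exists (x 0%N), 0%N.
  by exists (x 0%N + 1%:R^-1 *: e) => _ [j _ <-]; exact: xle.
have s1 k : x k <= s by apply: ss.1; exists k.
have s2 k : s <= x k + k.+1%:R^-1 *: e by apply: ss.2 => _ [j _ <-].
exists s; apply: L0P; near=> w.
have h1 : forall k, L0_repr (stone_rep (x k)) w <= L0_repr (stone_rep s) w.
  near: w; apply: ae_foralln => k; apply/L0_leE.
  by rewrite (lattice_iso_le iso).
have h2 : forall k, L0_repr (stone_rep s) w <= L0_repr (stone_rep (x k)) w + k.+1%:R^-1.
  near: w; apply: ae_foralln => k; near=> w.
  have : L0_repr (stone_rep s) w <=
      L0_repr (stone_rep (x k) + k.+1%:R^-1 *: L0_class mu 1) w.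
    near: w; apply/L0_leE.
    by rewrite -stone_rep1 -linearZ -linearD (lattice_iso_le iso).
  have -> : L0_repr (stone_rep (x k) + k.+1%:R^-1 *: L0_class mu 1) w =
      L0_repr (stone_rep (x k)) w + L0_repr (k.+1%:R^-1 *: L0_class mu 1) w.
    by near: w; exact: L0_aeD.
  have -> : L0_repr (k.+1%:R^-1 *: L0_class mu 1) w =
      k.+1%:R^-1 * L0_repr (L0_class mu 1) w by near: w; exact: L0_aeZ.
  have -> : L0_repr (L0_class mu 1) w = 1 by near: w; exact: L0_ae1.
  by rewrite mulr1.
have h3 : forall k, L0_repr (stone_rep (x k)) w <= L0_repr f w <=
    L0_repr (stone_rep (x k)) w + k.+1%:R^-1 by near: w; apply: ae_foralln.
apply/eqP; rewrite eq_le; apply/andP; split; apply/ler_addgt0Pl => eps /ltr_add_invr[k];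
  rewrite add0r => /ltW keps; have /andP[h4 h5] := h3 k; rewrite addrC.
  exact: le_trans (h2 k) (lerD h4 keps).
exact: le_trans h5 (lerD (h1 k) keps).
Unshelve. all: by end_near. Qed.

Lemma stone_rep_onto : onto stone_rep.
Proof.
move=> f; have [x xf] := stone_rep_onto_ge0 (rpos_ge0 f).
have [y yf] := stone_rep_onto_ge0 (rpos_ge0 (- f)).
by exists (x - y); rewrite linearB /= xf yf rposB.
Qed.

End surjectivity.

End stone_representation.

Lemma laterally_complete_representation (R : realType) (E : rieszSpaceType R) (e : E)
    (psi : {scalar ideal_type (principal_ideal e)}) :
  dedekind_complete E -> weak_order_unit e -> strictly_positive psi ->
  order_continuous psi -> laterally_complete E ->
  exists (d : measure_display) (X : measurableType d)
    (mu : probability X R) (T : {linear E -> L0 mu}), L0_representation e T.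
Proof.
move=> hE he psi_pos psi_oc hL.
exists _, _, _, (stone_rep hE he psi_pos psi_oc); split.
- exact: stone_rep_isomorphism.
- exact: stone_rep_onto.
- exact: stone_rep1.
Qed.
(* [phi (y a)] reaches its infimum over the net along an increasing sequence of
   indices; by strict positivity, the infimum of [y] along that sequence is a lower
   bound of the whole net. *)
Lemma order_continuous_of_sequences (R : realType) (G : rieszSpaceType R)
    (phi : {scalar G}) : strictly_positive phi ->
  (forall y : nat -> G, (forall n, 0 <= y n) ->
    (forall m n, (m <= n)%N -> y n <= y m) ->
    exists z, infimums (range y) z /\
      forall eps, 0 < eps -> exists n, phi (y n) < phi z + eps) ->
  order_continuous phi.
Proof.
move=> phi_pos phi_seq A x [y [[yd [y0 yinf]] xy]].
have phi_ge0 z : 0 <= z -> 0 <= phi z.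
  by rewrite le_eqVlt => /predU1P[<-|/phi_pos/ltW//]; rewrite raddf0.
have phi_le u v : u <= v -> phi u <= phi v.
  by rewrite -riesz_subr_ge0 => /phi_ge0; rewrite raddfB subr_ge0.
have {}y0 a : 0 <= y a by apply: y0; exists a.
pose W := [set phi (y a) | a in setT].
have W_inf : has_inf W.
  split; first by case: (dle_inhabited A) => a; exists (phi (y a)), a.
  by exists 0 => _ [a _ <-]; exact: phi_ge0.
have cle a : inf W <= phi (y a) by apply: inf_lbound; [exact: W_inf.2|exists a].
have /choice[a aP] n : exists a, phi (y a) < inf W + n.+1%:R^-1.
  have n0 : 0 < n.+1%:R^-1 :> R by rewrite invr_gt0 ltr0n.
  by have [_ [a _ <-] h] := inf_adherent n0 W_inf; exists a.
have /choice[j jP] (p : A * A) : exists c, dle p.1 c /\ dle p.2 c.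
  exact: dle_directed.
(* Directedness turns the almost minimising indices [a n] into an increasing sequence dominating
   them. *)
pose b := fix b n := if n is m.+1 then j (b m, a m.+1) else a 0%N.
have bS n : dle (b n) (b n.+1) := (jP (b n, a n.+1)).1.
have ab n : dle (a n) (b n).
  by case: n => [|n]; [exact: dle_refl|exact: (jP (b n, a n.+1)).2].
have bd m n : (m <= n)%N -> dle (b m) (b n).
  elim: n => [|n IH]; first by rewrite leqn0 => /eqP ->; exact: dle_refl.
  rewrite leq_eqVlt => /predU1P[->|/IH h]; first exact: dle_refl.
  exact: dle_trans h (bS n).
have [|m n mn|z [[zy yz] phiz]] := phi_seq (y \o b); first by move=> n; exact: y0.
  exact/yd/bd.
have phizc : phi z <= inf W.
  apply/ler_addgt0Pl => eps /ltr_add_invr[n]; rewrite add0r => hn.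
  apply: (@le_trans _ _ (phi (y (b n)))); first by apply: phi_le; apply: zy; exists n.
  apply: le_trans (phi_le _ _ (yd _ _ (ab n))) _.
  by apply: le_trans (ltW (aP n)) _; rewrite addrC lerD// ltW.
(* The hypothesis is applied again, to [y (b n) /\ y c], whose infimum [z'] is below [z]. Each of
   these meets dominates a term of the net, so [phi z' >= inf W >= phi z], and strict positivity
   forces [z' = z]. *)
have zley c : z <= y c.
  have [|m n mn|z' [[z'y yz'] phiz']] := phi_seq (fun n => y (b n) `/\` y c).
  - by move=> n; rewrite riesz_meet_ge0.
  - by rewrite leI2//; apply/yd/bd.
  have z'z : z' <= z.
    apply: yz => _ [n _ <-]; have : z' <= y (b n) `/\` y c by apply: z'y; exists n.
    by rewrite lexI => /andP[].
  have cz' : inf W <= phi z'.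
    apply/ler_addgt0Pr => eps /phiz'[n /ltW]; apply: le_trans.
    have [k [bk ck]] := dle_directed (b n) c.
    by apply: le_trans (cle k) _; apply: phi_le; rewrite lexI !yd.
  have : ~ (0 < z - z').
    move=> /phi_pos; rewrite raddfB subr_gt0 => h.
    by have := lt_le_trans h (le_trans phizc cz'); rewrite ltxx.
  move/negP; rewrite lt_neqAle riesz_subr_ge0 z'z andbT negbK eq_sym subr_eq0 => /eqP ->.
  have : z' <= y (b 0%N) `/\` y c by apply: z'y; exists 0%N.
  by rewrite lexI => /andP[].
have z0 : z <= 0 by apply: yinf => _ [c _ <-].
have c0 : inf W <= 0.
  have z_eq0 : z = 0.
    by apply/eqP; rewrite eq_le z0; apply: yz => _ [n _ <-]; exact: y0.
  apply/ler_addgt0Pl => eps /phiz[n /ltW]; rewrite z_eq0 raddf0 add0r addr0.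
  exact: le_trans (cle _).
apply/cvgrPdist_lt => eps eps0.
have [_ [c _ <-] hc] := inf_adherent eps0 W_inf.
exists c => // k /= ck; rewrite sub0r normrN.
have hx : rabs (x k) <= y c.
  by rewrite -[x k]subr0; apply: le_trans (xy k) (yd _ _ ck).
apply: (@le_lt_trans _ _ (phi (y c))); last by apply: lt_le_trans hc _; rewrite gerDr.
have h1 : x k <= y c by exact: le_trans (rabs_ler _) hx.
have h2 : - y c <= x k by rewrite -[x k]opprK riesz_leN2; exact: le_trans (rabs_leN _) hx.
by rewrite ler_norml -(raddfN phi) (phi_le _ _ h1) (phi_le _ _ h2).
Qed.

(** * The functional and the metric induced by a representation *)

Section min1_series.
Context {R : realType}.

(** The summands tend to 0, so from some [N] on they are below 1 and equal to the increments
    themselves; the telescoping series then converges absolutely. *)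
Lemma cvgn_min1 (a : nat -> R) (M : R) :
  (forall n, \sum_(0 <= k < n) Num.min `|a k.+1 - a k| 1 <= M) -> cvgn a.
Proof.
move=> aM; pose h k := Num.min `|a k.+1 - a k| 1.
have h0 k : 0 <= h k by rewrite le_min normr_ge0 ler01.
have hS n m : (n <= m)%N -> \sum_(0 <= k < n) h k <= \sum_(0 <= k < m) h k.
  by move=> nm; rewrite [leRHS](big_cat_nat _ nm)//= lerDl sumr_ge0.
have : cvgn (series h).
  apply: nondecreasing_is_cvgn; first exact: hS.
  by exists M => _ [n _ <-]; exact: aM.
move=> /cvg_series_cvg_0 /cvgrPdist_lt /(_ _ ltr01)[N _ hN].
have hE k : (N <= k)%N -> h k = `|a k.+1 - a k|.
  move=> /hN; rewrite /= sub0r normrN ger0_norm// /h /Num.min.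
  by case: ifP => // _; rewrite ltxx.
pose b n := a (n + N)%N.
suff : cvgn b.
  by move=> /cvg_ex[l bl]; apply/cvg_ex; exists l; rewrite -(cvg_shiftn N).
have : cvgn (series (telescope b)).
  apply: normed_cvg; apply: nondecreasing_is_cvgn.
    by apply: nondecreasing_series => n _ _; exact: normr_ge0.
  exists M => _ [n _ <-]; apply: le_trans (aM (n + N)%N).
  rewrite [leLHS](_ : _ = \sum_(N <= k < n + N) h k).
    by rewrite [leRHS](big_cat_nat (leq0n N) (leq_addl n N))/= lerDr sumr_ge0.
  rewrite /series/= -{1}[N]add0n big_addn addnK; apply: eq_bigr => k _.
  by rewrite hE ?leq_addl// /telescope /b addSn.
rewrite telescopeK => /cvg_ex[l]; move: (b 0%N) => c hl.
apply/cvg_ex; exists (l + c).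
have -> : b = (fun n => b n - c + c) by apply/funext => n; rewrite subrK.
by apply: cvgD; [exact: hl|exact: cvg_cst].
Qed.

End min1_series.

(** * Almost everywhere limits and bounded convergence on a probability space *)

Section probability_integrals.
Context d (X : measurableType d) (R : realType) (mu : probability X R).
Implicit Types f g : {mfun X >-> R}.

(** The upper limit in the extended reals is measurable on the whole space, and [fine] makes it real
    valued without changing it at points of convergence. *)
Lemma ae_limit_mfun (f_ : nat -> {mfun X >-> R}) :
  (\forall w \ae mu, cvgn (fun n => f_ n w)) ->
  exists f : {mfun X >-> R}, \forall w \ae mu, f_ n w @[n --> \oo] --> f w.
Proof.
move=> fcvg; pose h w := fine (limn_esup (fun n => (f_ n w)%:E)).
have mh : measurable_fun setT h.
  apply: measurableT_comp => //; apply: measurable_fun_limn_esup => n.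
  exact: measurableT_comp.
exists (mk_mfun mh); apply: filterS fcvg => w /cvg_ex[l fl].
have fl' : (f_ n w)%:E @[n --> \oo] --> l%:E by apply: cvg_EFin => //; near=> n.
rewrite (_ : mk_mfun mh w = l)//.
rewrite /= /h is_cvg_limn_esupE; last by apply/cvg_ex; exists l%:E.
by rewrite (cvg_lim _ fl').
Unshelve. all: by end_near. Qed.

Lemma ae_bounded_integrable f (M : R) : (\forall w \ae mu, `|f w| <= M) ->
  mu.-integrable setT (EFin \o f).
Proof.
move=> fM; apply/integrableP; split; first exact: measurableT_comp.
apply: (@le_lt_trans _ _ (\int[mu]_w (cst `|M|%:E w))%E).
  apply: ae_ge0_le_integral => //.
  - by apply: measurableT_comp => //; exact: measurableT_comp.
  - by move=> w _; rewrite lee_fin.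
  - by apply: filterS fM => w fw _ /=; rewrite lee_fin (le_trans fw)// ler_norm.
by rewrite integral_cst// [X in (_ * X)%E](probability_setT mu) mule1 ltry.
Qed.

Lemma ae_eq_Rintegral f (g : X -> R) : measurable_fun setT g ->
  (\forall w \ae mu, f w = g w) -> Rintegral mu setT f = Rintegral mu setT g.
Proof.
move=> mg fg; congr fine; apply: ae_eq_integral => //.
- exact: measurableT_comp.
- exact: measurableT_comp.
- by apply: filterS fg => w -> _.
Qed.

Lemma Rintegral_dominated_cvg (f_ : nat -> {mfun X >-> R}) f (M : R) :
  (forall n, \forall w \ae mu, `|f_ n w| <= M) ->
  (\forall w \ae mu, f_ n w @[n --> \oo] --> f w) ->
  Rintegral mu setT (f_ n) @[n --> \oo] --> Rintegral mu setT f.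
Proof.
move=> fM ff.
have [|||||fi _ cv] := @dominated_convergence _ X R mu setT measurableT
  (fun n => EFin \o f_ n) (EFin \o f) (EFin \o cst M).
- by move=> n; exact: measurableT_comp.
- exact: measurableT_comp.
- by apply: filterS ff => w fw _; apply: cvg_EFin => //; exact: nearW.
- exact: finite_measure_integrable_cst.
- move/ae_foralln : fM; apply: filterS => w fw n _.
  by rewrite /= lee_fin.
have fin_f : (\int[mu]_x (EFin \o f) x)%E \is a fin_num by exact: integrable_fin_num.
by apply: fine_cvg; rewrite fineK.
Qed.

End probability_integrals.

(** * Transport of the ideal, the integral and convergence in measure *)

Section L0_isomorphism.
Context {R : realType} {E : rieszSpaceType R} {e : E}.
Context d (X : measurableType d) (mu : probability X R) (T : {linear E -> L0 mu}).
Variable he : weak_order_unit e.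
Hypothesis hT : L0_representation e T.
Implicit Types x y : E.
Let e0 : 0 <= e := weak_unit_ge0 he.
Local Notation U := (ideal_type (principal_ideal e)).
Local Notation rep x := (L0_repr (T x)).

Let iso : lattice_isomorphism T. Proof. by case: hT. Qed.
Let surj : onto T. Proof. by case: hT. Qed.

Lemma rep_unit : \forall w \ae mu, rep e w = 1.
Proof. by have [_ _ ->] := hT; exact: L0_ae1. Qed.

Lemma rep_le x y : x <= y <-> \forall w \ae mu, rep x w <= rep y w.
Proof. by rewrite -(lattice_iso_le iso); exact: L0_leE. Qed.

Lemma repZ_unit (a : R) : \forall w \ae mu, rep (a *: e) w = a.
Proof.
rewrite linearZ; apply: filterS2 (L0_aeZ a (T e)) rep_unit => w -> ->.
exact: mulr1.
Qed.

Lemma rep_rabs x : \forall w \ae mu, rep (rabs x) w = `|rep x w|.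
Proof.
rewrite (lattice_iso_rabs iso).
apply: filterS2 (L0_aeU (T x) (- T x)) (L0_aeN (T x)) => w -> ->.
exact: maxrN.
Qed.

Lemma rep_ge0 x : 0 <= x <-> \forall w \ae mu, 0 <= rep x w.
Proof.
rewrite rep_le linear0; split=> h; apply: filterS2 h (L0_ae0 mu) => w.
  by move=> + <-.
by move=> + ->.
Qed.

Lemma rep_realize (f : {mfun X >-> R}) : exists x, \forall w \ae mu, rep x w = f w.
Proof.
by have [x xf] := surj (L0_class mu f); exists x; rewrite xf; exact: L0_classE.
Qed.

Lemma rep_bounded (x : E) (l : R) : rabs x <= l *: e <->
  \forall w \ae mu, `|rep x w| <= l.
Proof.
rewrite rep_le; split=> h.
  by apply: filterS3 h (rep_rabs x) (repZ_unit l) => w + <- <-.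
by apply: filterS3 h (rep_rabs x) (repZ_unit l) => w + -> ->.
Qed.

Lemma principal_Linfty : {homo T : x / principal_set e x >-> Linfty_set x}.
Proof. by move=> x [l /rep_bounded h]; apply/Linfty_setP; exists l. Qed.

(** The representation itself restricts: since [T e = 1], a bound [|x| <= l e] means that
    [|T x| <= l] almost everywhere. *)
Lemma Linfty_isomorphism : exists S : {linear U -> ideal_type (Linfty mu)},
  lattice_isomorphism S /\ onto S.
Proof.
have mem (u : U) : T (ideal_val u) \in ideal_pred (Linfty mu).
  by rewrite inE; apply: principal_Linfty; have := ideal_valP u; rewrite inE.
pose S (u : U) : ideal_type (Linfty mu) := IdealElt (mem u).
have Slin : linear S by move=> a u v; apply: val_inj; rewrite /= linearP.
pose Sl : {linear U -> ideal_type (Linfty mu)} :=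
  HB.pack S (GRing.isLinear.Build R U (ideal_type (Linfty mu)) _ S Slin).
exists Sl; split.
  split=> [u v /(congr1 val) /= /(lattice_iso_inj iso) uv|u v|u v].
  - exact: val_inj.
  - by apply: val_inj; rewrite /= (lattice_iso_join iso).
  - by apply: val_inj; rewrite /= (lattice_iso_meet iso).
move=> f; have [x xf] := surj (ideal_val f).
have xU : x \in ideal_pred (principal_ideal e).
  have := ideal_valP f; rewrite !inE /= => /Linfty_setP[M fM].
  by exists M; apply/rep_bounded; rewrite xf.
by exists (IdealElt xU); apply: val_inj.
Qed.

Lemma ideal_rep_bounded (u : U) : exists M, \forall w \ae mu, `|rep (ideal_val u) w| <= M.
Proof. by have := ideal_valP u; rewrite inE => -[l /rep_bounded h]; exists l. Qed.

Lemma ideal_rep_integrable (u : U) : mu.-integrable setT (EFin \o rep (ideal_val u)).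
Proof. by have [M /ae_bounded_integrable] := ideal_rep_bounded u. Qed.

Definition rep_integral (u : U) : R := Rintegral mu setT (rep (ideal_val u)).

Lemma rep_integral_scalar : scalar rep_integral.
Proof.
move=> a u v; rewrite /rep_integral.
have iu := ideal_rep_integrable u; have iv := ideal_rep_integrable v.
have iau : mu.-integrable setT (EFin \o (fun w => a * rep (ideal_val u) w)).
  rewrite (_ : _ \o _ = (fun w => a%:E * (EFin \o rep (ideal_val u)) w)%E)//.
  exact: integrableZl.
rewrite -RintegralZl// -RintegralD//; apply: ae_eq_Rintegral.
  by apply: measurable_funD => //; exact: measurable_funM.
rewrite /= linearP.
by apply: filterS2 (L0_aeD (a *: T (ideal_val u)) (T (ideal_val v)))
  (L0_aeZ a (T (ideal_val u))) => w -> ->.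
Qed.

HB.instance Definition _ := GRing.isLinear.Build R U R *%R rep_integral
  rep_integral_scalar.

Lemma rep_integral_ge0 (u : U) : 0 <= u ->
  rep_integral u = Rintegral mu setT (fun w => `|rep (ideal_val u) w|).
Proof.
rewrite ideal_leE /= => /rep_ge0 u0; apply: ae_eq_Rintegral.
  exact: measurableT_comp.
by apply: filterS u0 => w /ger0_norm.
Qed.

Lemma rep_integral_positive : strictly_positive rep_integral.
Proof.
move=> u; rewrite lt_neqAle => /andP[u_neq0 u0].
rewrite -[ltRHS]/(rep_integral u) rep_integral_ge0// lt_neqAle Rintegral_ge0// andbT.
apply: contra_neq u_neq0 => I0; apply: val_inj; apply: (lattice_iso_inj iso).
rewrite /= linear0; apply: L0P.
have : (\int[mu]_w `|(EFin \o rep (ideal_val u)) w| = 0)%E.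
  rewrite -[LHS]fineK ?[X in X%:E](_ : _ = 0)//.
  by apply: integrable_fin_num => //; apply: integrable_abse; exact: ideal_rep_integrable.
move/ae_eq_integral_abs => /(_ measurableT) h.
have /h : measurable_fun setT (EFin \o rep (ideal_val u)) by exact: measurableT_comp.
by apply: filterS2 (L0_ae0 mu) => w -> /(_ I) [].
Qed.


(** For a decreasing sequence the infimum is the pointwise limit, which surjectivity of [T] realizes
    in [E]; it lies in the ideal, being between 0 and [y 0]. Dominated convergence, with a bound of
    [y 0], gives the values. *)
Lemma rep_integral_order_continuous : order_continuous rep_integral.
Proof.
apply: order_continuous_of_sequences rep_integral_positive _ => y y0 yd.
have gy0 n : \forall w \ae mu, 0 <= rep (ideal_val (y n)) w.
  by apply/rep_ge0; have := y0 n; rewrite ideal_leE.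
have gyd m n : (m <= n)%N ->
    \forall w \ae mu, rep (ideal_val (y n)) w <= rep (ideal_val (y m)) w.
  by move=> /yd; rewrite ideal_leE => /rep_le.
have mono : \forall w \ae mu, (forall n, 0 <= rep (ideal_val (y n)) w) /\
    nonincreasing_seq (fun n => rep (ideal_val (y n)) w).
  near=> w; split; first by near: w; exact: ae_foralln.
  apply/nonincreasing_seqP => n.
  have : forall n, rep (ideal_val (y n.+1)) w <= rep (ideal_val (y n)) w.
    by near: w; apply: ae_foralln => k; exact: gyd.
  exact.
have cvy : \forall w \ae mu, cvgn (fun n => rep (ideal_val (y n)) w).
  apply: filterS mono => w [w0 wd]; apply: nonincreasing_is_cvgn => //.
  by exists 0 => _ [n _ <-].
have [f yf] := ae_limit_mfun cvy.
have [z zf] := rep_realize f.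
have yz : \forall w \ae mu, rep (ideal_val (y n)) w @[n --> \oo] --> rep z w.
  by apply: filterS2 yf zf => w + ->.
have zy n : z <= ideal_val (y n).
  apply/rep_le; apply: filterS2 yz mono => w wz [w0 wd].
  rewrite -(cvg_lim _ wz)//; apply: nonincreasing_cvgn_ge => //.
  by apply/cvg_ex; exists (rep z w).
have z0 : 0 <= z.
  apply/rep_ge0; apply: filterS2 yz mono => w wz [w0 wd].
  rewrite -(cvg_lim _ wz)//; apply: limr_ge; first by apply/cvg_ex; exists (rep z w).
  exact: nearW.
have zU : z \in ideal_pred (principal_ideal e).
  rewrite inE; apply: (@ideal_solid _ _ _ _ (ideal_val (y 0%N))).
    by have := ideal_valP (y 0%N); rewrite inE.
  by rewrite !ger0_rabs// (le_trans z0).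
exists (IdealElt zU); split.
  split=> [_ [n _ <-]|l ly]; first by rewrite ideal_leE /=.
  rewrite ideal_leE /=; apply/rep_le.
  have : \forall w \ae mu, forall n, rep (ideal_val l) w <= rep (ideal_val (y n)) w.
    apply: ae_foralln => n; apply/rep_le.
    by have := ly (y n) (ex_intro2 _ _ n I erefl); rewrite ideal_leE.
  apply: filterS2 yz => w wz wl.
  rewrite -(cvg_lim _ wz)//; apply: limr_ge; first by apply/cvg_ex; exists (rep z w).
  exact: nearW.
have [M yM] := ideal_rep_bounded (y 0%N).
have : rep_integral (y n) @[n --> \oo] --> rep_integral (IdealElt zU).
  apply: (@Rintegral_dominated_cvg _ _ _ mu (fun n => rep (ideal_val (y n))) _ M) => // n.
  apply: filterS3 yM mono (gyd _ _ (leq0n n)) => w w0M [w0 _] wn.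
  by rewrite ger0_norm//; apply: le_trans wn _; apply: le_trans (ler_norm _) w0M.
move=> /cvgrPdist_lt h eps /h [N _ hN]; exists N.
have := hN N (leqnn N); rewrite /= distrC => /ltr_distlDr.
by rewrite addrC.
Unshelve. all: by end_near. Qed.

Lemma trunc_fun_rep_integral x : trunc_fun he rep_integral x =
  Rintegral mu setT (fun w => Num.min `|rep x w| 1).
Proof.
apply: ae_eq_Rintegral.
  by apply: measurable_minr => //; exact: measurableT_comp.
rewrite /= (lattice_iso_meet iso).
by apply: filterS3 (L0_aeI (T (rabs x)) (T e)) (rep_rabs x) rep_unit => w -> -> ->.
Qed.

Lemma rep_integral_complete :
  complete_metric (metric_dphi he rep_integral_positive).
Proof.
apply/complete_metric_dphiP => u ucauchy.
pose F := trunc_fun he rep_integral.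
have /choice[N NP] k : exists N, forall m n, (N <= m)%N -> (N <= n)%N ->
    F (u m - u n) < 2^-1 ^+ k.
  by apply: ucauchy; rewrite exprn_gt0// invr_gt0.
(* Summing the thresholds gives indices that are nondecreasing and each at least [N k]. *)
pose K k := \sum_(0 <= j < k.+1) N j.
have NK k : (N k <= K k)%N by rewrite /K big_nat_recr//= leq_addl.
have KS k : (K k <= K k.+1)%N by rewrite /K [leqRHS]big_nat_recr//= leq_addr.
pose v k := u (K k).
have Fv k : F (v k.+1 - v k) <= 2^-1 ^+ k.
  by apply/ltW/NP => //; exact: leq_trans (NK k) (KS k).
pose h k w := Num.min `|rep (v k.+1) w - rep (v k) w| 1.
have h0 k w : 0 <= h k w by rewrite le_min normr_ge0 ler01.
have h1 k w : h k w <= 1 by rewrite ge_min lexx orbT.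
have mh k : measurable_fun setT (h k).
  apply: measurable_minr => //; apply: measurableT_comp => //.
  exact: measurable_funB.
have hi k : mu.-integrable setT (EFin \o h k).
  apply: (@ae_bounded_integrable _ _ _ mu (mk_mfun (mh k)) 1); apply: nearW => w.
  by rewrite /= ger0_norm.
have Ih k : (\int[mu]_w (h k w)%:E <= (2^-1 ^+ k)%:E)%E.
  rewrite -[leLHS]fineK; last exact: integrable_fin_num (hi k).
  rewrite lee_fin; apply: le_trans (Fv k); rewrite le_eqVlt; apply/orP; left; apply/eqP.
  rewrite /F trunc_fun_rep_integral; apply: (@ae_eq_Rintegral _ _ _ mu (mk_mfun (mh k))).
    by apply: measurable_minr => //; exact: measurableT_comp.
  rewrite linearB; apply: filterS (L0_aeB (T (v k.+1)) (T (v k))) => w.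
  by move=> ->.
(* The integrals [2^-k] are summable, so the truncated increments have a finite sum almost
   everywhere, as [cvgn_min1] requires. *)
have Isum : (\int[mu]_w (\sum_(k <oo) (h k w)%:E) <= 2%:E)%E.
  rewrite integral_nneseries//; last 2 first.
  - by move=> k; exact: measurableT_comp.
  - by move=> k w _; rewrite lee_fin.
  apply: lime_le.
    apply: is_cvg_nneseries => k _ _; apply: integral_ge0 => w _.
    by rewrite lee_fin.
  apply: nearW => n; apply: (@le_trans _ _ (\sum_(0 <= k < n) (2^-1 ^+ k)%:E)%E).
    exact: lee_sum.
  rewrite sumEFin lee_fin; apply: le_trans (geometric_half_sum R 0 n) _.
  by rewrite expr0 mulr1.
have mS : measurable_fun setT (fun w => (\sum_(k <oo) (h k w)%:E)%E).
  apply: ge0_emeasurable_sum => k; last by move=> *; exact: measurableT_comp.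
  by move=> w _ _; rewrite lee_fin.
have S0 w : (0 <= \sum_(k <oo) (h k w)%:E)%E.
  by apply: nneseries_ge0 => k _ _; rewrite lee_fin.
have cvv : \forall w \ae mu, cvgn (fun n => rep (v n) w).
  have : mu.-integrable setT (fun w => (\sum_(k <oo) (h k w)%:E)%E).
    apply/integrableP; split=> //.
    under eq_integral do rewrite gee0_abs//.
    exact: le_lt_trans Isum (ltry _).
  move=> /(integrable_ae measurableT); apply: filterS => w /(_ I) wfin.
  apply: (@cvgn_min1 _ _ (fine (\sum_(k <oo) (h k w)%:E)%E)) => n.
  rewrite -lee_fin fineK// -sumEFin.
  by apply: nneseries_lim_ge => k _ _; rewrite lee_fin.
have [f vf] := ae_limit_mfun cvv.
have [l lf] := rep_realize f.
(* Truncation supplies the dominating constant 1, however large the differences are. *)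
have Fl : F (l - v n) @[n --> \oo] --> (0 : R).
  have mg n : measurable_fun setT (fun w => Num.min `|rep (l - v n) w| 1).
    by apply: measurable_minr => //; exact: measurableT_comp.
  rewrite (_ : (fun n => _) = (fun n => Rintegral mu setT (mk_mfun (mg n)))); last first.
    by apply/funext => n; rewrite /F trunc_fun_rep_integral.
  rewrite (_ : 0 = Rintegral mu setT (mk_mfun (measurable_cst (0 : R)))); last first.
    by rewrite /Rintegral integral0_eq.
  apply: (@Rintegral_dominated_cvg _ _ _ mu (fun n => mk_mfun (mg n)) _ 1).
    move=> n; apply: nearW => w /=.
    by rewrite ger0_norm ?ge_min ?lexx ?orbT// le_min normr_ge0 ler01.
  near=> w => /=.
  have vE : forall n, rep (l - v n) w = rep l w - rep (v n) w.
    by near: w; apply: ae_foralln => n; rewrite linearB; exact: L0_aeB.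
  have wl : rep (v n) w @[n --> \oo] --> rep l w.
    have -> : rep l w = f w by near: w; exact: lf.
    by near: w; exact: vf.
  apply/cvgrPdist_lt => eps eps0; move/cvgrPdist_lt : wl => /(_ _ eps0).
  apply: filterS => n; rewrite -vE sub0r normrN => hn.
  rewrite ger0_norm ?le_min ?normr_ge0 ?ler01//.
  by apply: le_lt_trans hn; rewrite ge_min lexx.
exists l => eps eps0.
have eps20 : 0 < eps / 2 by rewrite divr_gt0.
move/cvgrPdist_lt : Fl => /(_ _ eps20)[n1 _ hn1].
have [n2 hn2] := expr_half_lt eps20.
pose n := maxn n1 n2; exists (K n) => m Km.
have -> : l - u m = (l - v n) + (v n - u m) by rewrite addrA subrK.
apply: le_lt_trans (trunc_funD_le _ rep_integral_positive _ _) _.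
have := hn1 n (leq_maxl n1 n2); rewrite /= sub0r normrN.
rewrite ger0_norm ?trunc_fun_ge0//; last exact: rep_integral_positive.
have : F (v n - u m) < 2^-1 ^+ n by apply: NP; [exact: NK|exact: leq_trans (NK n) Km].
have : 2^-1 ^+ n <= 2^-1 ^+ n2 :> R.
  by rewrite ler_wiXn2l ?leq_maxr// ?invr_ge0// invf_le1// ler1n.
by rewrite -/F; move: hn2; lra.
Unshelve. all: by end_near. Qed.

End L0_isomorphism.

(** * The cycle of implications and its consequences *)

Theorem theorem2p2 (R : realType) (E : rieszSpaceType R) (e : E)
    (hE : dedekind_complete E) (he : weak_order_unit e) :
  let cond_i :=
    exists (d : measure_display) (X : measurableType d)
      (mu : probability X R) (T : {linear E -> L0 mu}),
      L0_representation e T in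
  let cond_ii :=
    exists (phi : {scalar ideal_type (principal_ideal e)})
      (hphi : strictly_positive phi),
      order_continuous phi /\ complete_metric (metric_dphi he hphi) in
  let cond_iii :=
    (exists psi : {scalar ideal_type (principal_ideal e)},
      strictly_positive psi /\ order_continuous psi) /\
    laterally_complete E in
  [/\ (cond_i <-> cond_ii),
      (cond_ii <-> cond_iii) &
      cond_i ->
      [/\ forall (d : measure_display) (X : measurableType d)
            (mu : probability X R) (T : {linear E -> L0 mu}),
            L0_representation e T ->
            exists S : {linear ideal_type (principal_ideal e) ->
                          ideal_type (Linfty mu)},
              lattice_isomorphism S /\ onto S,
          forall (phi psi : {scalar ideal_type (principal_ideal e)})
            (hphi : strictly_positive phi) (hpsi : strictly_positive psi),
            order_continuous phi -> complete_metric (metric_dphi he hphi) ->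
            order_continuous psi -> laterally_complete E ->
            (@open (metric_dphi he hphi) : set (set E)) =
            @open (metric_dphi he hpsi) &
          countable_sup_property E]].
Proof.
move=> cond_i cond_ii cond_iii.
have i_ii : cond_i -> cond_ii.
  move=> [d [X [mu [T hT]]]]; exists (rep_integral T), (rep_integral_positive hT).
  split; first exact: rep_integral_order_continuous.
  exact: rep_integral_complete.
have ii_iii : cond_ii -> cond_iii.
  move=> [phi [hphi [phi_oc phi_complete]]]; split; first by exists phi.
  exact: complete_laterally_complete phi_complete.
have iii_i : cond_iii -> cond_i.
  move=> [[psi [hpsi psi_oc]] hL].
  exact: laterally_complete_representation hE he hpsi psi_oc hL.
split; [by split=> // /ii_iii/iii_i|by split=> // /iii_i/i_ii|].
(* The countable sup property is proved with a functional, which (i) supplies through (ii). *)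
move=> /i_ii[phi [hphi [phi_oc _]]]; split.
- move=> d X mu T hT; exact: Linfty_isomorphism hT.
- by move=> phi' psi hphi' hpsi phi'_oc _ psi_oc _; exact: open_metric_dphi_eq.
- exact: countable_sup hphi phi_oc.
Qed.
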